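(* Let $X$ be the subshift obtained from the marker construction described in the context (it has topological entropy dimension $1/2$), and $\mu$ its unique shift-invariant probability measure. For $x\in X$ and $n \in \mathbb{N}$ let $P_n(x) = \{y \in X : y_i = x_i \text{ for } 0\le i<n\}$. Then: (1) For $\mu$-a.e. $x \in X$, the quantity $\limsup_{n\to\infty} -\frac{1}{n^{\beta}}\log\mu(P_n(x))$, as a function of $\beta>0$, has critical value $1/2$. (2) There is a set $\hat X \subset X$ with $\mu(\hat X) = 1$ such that for every $\tau \in [0,1/2]$ there is an increasing sequence $(n_j)_{j\in\mathbb{N}}$ of positive integers such that for each $x \in \hat X$, the quantity $\lim_{j\to\infty} -\frac{1}{(n_j)^{\beta}}\log\mu(P_{n_j}(x))$, as a function of $\beta > 0$, has critical value $\tau$.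
   Context: Marker construction. Let $l_1$ be a sufficiently large perfect square and $N_1 = 2^{\sqrt{l_1}}$. Let $\mathcal{C}_1$ be a set of $N_1$ binary words of length $l_1$, each beginning with $001$, such that the word $00$ occurs in each element of $\mathcal{C}_1$ only as its prefix. Inductively, given a set $\mathcal{C}_j$ of $N_j$ distinct words of length $l_j$ with an ordering $\mathcal{C}_j = \{u_1^{(j)},\dots,u_{N_j}^{(j)}\}$, let $P_j = \{2\}\cup\{i^2 : 2 \le i \le \lfloor\sqrt{N_j}\rfloor\}$, and let $\mathcal{C}_{j+1}$ be the set of all words $u^{(j)}_{\pi(1)}\cdots u^{(j)}_{\pi(N_j)}$ where $\pi$ ranges over permutations of $\{1,\dots,N_j\}$ fixing every element outside $P_j$. Thus $N_{j+1} = (\lfloor\sqrt{N_j}\rfloor)!$, $l_{j+1} = l_j N_j$. The ordering of $\mathcal{C}_{j+1}$ is arbitrary except that its first element is $u_1^{(j)}u_2^{(j)}\cdots u_{N_j}^{(j)}$. $X \subset \{0,1\}^{\mathbb{Z}}$ is the set of bi-infinite sequences each finite subword of which is a subword of some word in $\bigcup_j \mathcal{C}_j$; it is strictly ergodic. Critical value: for a family of quantities $F(\beta)\in[0,\infty]$ indexed by $\beta>0$ (here a limsup or limit of $a_n/n^\beta$ with $a_n\ge 0$), we say $F$ has critical value $c$ if $F(\beta) = \infty$ for all $0<\beta<c$ and $F(\beta) = 0$ for all $\beta > c$ (for $c=0$: $F(\beta)=0$ for all $\beta>0$). *)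

(* Defs.v *)
From HB Require Import structures.
From mathcomp Require Import all_boot all_order all_algebra all_fingroup.
From mathcomp Require Import all_classical all_reals all_analysis.
Set Implicit Arguments. Unset Strict Implicit. Unset Printing Implicit Defensive.
Import Order.TTheory GRing.Theory Num.Theory.
Local Open Scope classical_set_scope.
Local Open Scope ring_scope.

(* 1-indexed position set P_j = {2} U {i^2 : 2 <= i <= floor(sqrt N)} *)
Definition Pset (N k : nat) : bool :=
  (k == 2)%N || [exists i : 'I_N.+1, [&& (2 <= i)%N, (i * i <= N)%N & (k == i * i)%N]].

Definition next_level_word (Cj : seq (seq bool)) (w : seq bool) : Prop :=
  exists pi : {perm 'I_(size Cj)},
    (forall i : 'I_(size Cj), ~~ Pset (size Cj) i.+1 -> pi i = i) /\
    w = flatten [seq nth [::] Cj (pi i) | i <- enum 'I_(size Cj)].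

(* Validity of C_1 (0-indexed here as C 0): N_1 = 2^r distinct words of length
   l_1 = r*r, each beginning with 001, in which 00 occurs only as the prefix. *)
Definition valid_C1 (r : nat) (C1 : seq (seq bool)) : Prop :=
  [/\ uniq C1, size C1 = (2 ^ r)%N &
      forall w, w \in C1 ->
        [/\ size w = (r * r)%N, take 3 w = [:: false; false; true] &
            forall i, (0 < i)%N -> (i.+1 < size w)%N ->
              ~ (nth true w i = false /\ nth true w i.+1 = false)]].

(* A marker construction: C j is C_{j+1} of the paper, listed in its ordering. *)
Definition marker_construction (r : nat) (C : nat -> seq (seq bool)) : Prop :=
  valid_C1 r (C 0%N) /\
  forall j, [/\ uniq (C j.+1),
               (forall w, w \in C j.+1 <-> next_level_word (C j) w) &
               head [::] (C j.+1) = flatten (C j)].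

Definition config := int -> bool.

Definition subword (x : config) (m : int) (n : nat) : seq bool :=
  mkseq (fun i => x (m + i%:Z)) n.

Definition marker_shift (C : nat -> seq (seq bool)) : set config :=
  [set x | forall (m : int) (n : nat),
     exists j, exists2 w, w \in C j & infix (subword x m n) w].

Definition sshift (x : config) : config := fun i => x (i + 1).

Definition cylinders : set (set config) :=
  [set A | exists (i : int) (b : bool), A = [set x | x i = b]].

Definition shift_space := g_sigma_algebraType cylinders.

Definition Pn (X : set config) (n : nat) (x : config) : set config :=
  [set y | X y /\ forall i : nat, (i < n)%N -> y i%:Z = x i%:Z].

Definition has_critical_value {R : realType} (F : R -> \bar R) (c : R) : Prop :=
  (forall b : R, 0 < b -> b < c -> F b = +oo%E) /\
  (forall b : R, c < b -> F b = 0%E).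

Definition crit_limsup {R : realType} (a : nat -> R) (c : R) : Prop :=
  has_critical_value
    (fun b => limn_esup (fun n => (a n / (n%:R `^ b))%:E)) c.

Definition crit_lim {R : realType} (a : nat -> R) (nj : nat -> nat) (c : R) : Prop :=
  (forall b : R, 0 < b -> b < c ->
     (fun j => a (nj j) / ((nj j)%:R `^ b)) @ \oo --> +oo) /\
  (forall b : R, c < b ->
     (fun j => a (nj j) / ((nj j)%:R `^ b)) @ \oo --> 0).

(* Main.v *)
Require Import Defs.
From HB Require Import structures.
From mathcomp Require Import all_boot all_order all_algebra all_fingroup.
From mathcomp Require Import zify.
Set Implicit Arguments. Unset Strict Implicit. Unset Printing Implicit Defensive.

(* Let N_j, l_j be the number and the length of the words of level j and
   S_j = |P_j| = floor (sqrt N_j), so N_{j+1} = S_j! and l_{j+1} = N_j l_j.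
   Every point of X has a unique parse into words of level j: 001 marks the
   starts at level 0, and the immovable first word u_1 marks them at every next
   level. Since each word of level j occurs exactly once in each word of level
   j+1, its cylinder has measure about 1/l_{j+1}. A window of length n <= N_j
   inside a word of level j+1 that meets s positions of P_j is shared by
   (S_j - s)! of the S_j! words, so that - log mu(P_n(x)) lies between about
   log s! and log (2 l_{j+1}) + s log S_j. When the origin is at distance at
   least N_j from both ends of its block (which by Borel-Cantelli holds for
   almost every x and all large j, as it fails with probability 2/l_j), s is
   about n / (l_j sqrt N_j), up to factors l_j that are polylogarithmic in N_j.
   For n = N_j^c with 1/2 <= c <= 1 the information is N_j^(c - 1/2 + o(1)), of
   exponent 1 - 1/(2c) in n, which takes all the values in [0, 1/2]; and
   log N_j <= sqrt N_{j-1} log N_{j-1} gives the upper bound 8 sqrt n log n for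
   all large n. *)

(** * Words of the marker construction *)

Definition isqrt (n : nat) : nat := \max_(i < n.+1 | i * i <= n) i.

Lemma isqrt_sq_le n : isqrt n * isqrt n <= n.
Proof.
rewrite /isqrt; elim/big_ind: _ => // x y hx hy.
by rewrite /maxn; case: ifP.
Qed.

Lemma leq_isqrt n m : m * m <= n -> m <= isqrt n.
Proof.
move=> h; have mn : m < n.+1 by nia.
exact: (@leq_bigmax_cond _ (fun i : 'I_n.+1 => i * i <= n) (fun i => i) (Ordinal mn)).
Qed.

Lemma lt_isqrt_sq n : n < (isqrt n).+1 * (isqrt n).+1.
Proof. by rewrite ltnNge; apply/negP => /leq_isqrt; rewrite ltnn. Qed.

Lemma isqrt_le n m : m <= n -> isqrt m <= isqrt n.
Proof. by move=> h; apply: leq_isqrt; apply: leq_trans h; exact: isqrt_sq_le. Qed.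

(* The levels are numbered from 0: nwords r j and len r j are the N_{j+1} and
   l_{j+1} of the statement. *)
Fixpoint nwords (r j : nat) : nat :=
  if j is j'.+1 then (isqrt (nwords r j'))`! else 2 ^ r.

Fixpoint len (r j : nat) : nat :=
  if j is j'.+1 then nwords r j' * len r j' else r * r.

Lemma sq_le_exp2 r : 4 <= r -> r * r <= 2 ^ r.
Proof.
elim: r => // r IH; rewrite leq_eqVlt => /orP[/eqP <- //|h].
by have := IH h; rewrite expnS; nia.
Qed.

(** Used with s = floor (sqrt N): as N < (s+1)^2, it yields N^2 <= s!, so the number of words is at
    least squared from one level to the next. *)
Lemma fact_ge_quartic s : 8 <= s -> s.+1 ^ 4 <= s`!.
Proof.
elim: s => // s IH; rewrite leq_eqVlt => /orP[/eqP <- //|h].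
have {IH}: s.+1 ^ 4 <= s`! by exact: IH.
rewrite factS !expnS expn0 !muln1 => IH.
apply: (@leq_trans (s.+1 * (s.+1 * (s.+1 * (s.+1 * s.+1))))); last by rewrite leq_mul2l IH.
have h1 : 16 * s.+1 >= 16 * 9 by lia.
(* (s+2)^4 <= (9/8)^4 (s+1)^4, and (9/8)^4 < 9 <= s+1. *)
have h2 : 8 * s.+2 <= 9 * s.+1 by lia.
have h3 : 64 * (s.+2 * s.+2) <= 81 * (s.+1 * s.+1) by nia.
have h4 : 64 * 64 * (s.+2 * s.+2 * (s.+2 * s.+2)) <= 81 * 81 * (s.+1 * s.+1 * (s.+1 * s.+1)).
  have := leq_mul h3 h3; lia.
have : 9 * (s.+1 * s.+1 * (s.+1 * s.+1)) <= s.+1 * (s.+1 * s.+1 * (s.+1 * s.+1)) by nia.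
lia.
Qed.

(** 64 = 8^2 is where [fact_ge_quartic] starts to apply to the square root; r >= 6 secures it at
    level 0, and it then reproduces itself. *)
Lemma nwords_ge64 r j : 6 <= r -> 64 <= nwords r j.
Proof.
move=> hr; elim: j => [|j IH] /=.
  exact: (@leq_pexp2l 2 6 r).
have s8 : 8 <= isqrt (nwords r j) by apply: leq_isqrt.
have := fact_ge_quartic s8; apply: leq_trans.
have : 9 ^ 4 <= (isqrt (nwords r j)).+1 ^ 4 by rewrite leq_exp2r.
exact: leq_trans.
Qed.

Lemma nwords_sq_le r j : 6 <= r -> nwords r j * nwords r j <= nwords r j.+1.
Proof.
move=> hr; have s8 : 8 <= isqrt (nwords r j) by apply: leq_isqrt; exact: nwords_ge64.
apply: leq_trans (fact_ge_quartic s8).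
have := lt_isqrt_sq (nwords r j); rewrite !expnS expn0 muln1.
set t := (isqrt _).+1; set n := nwords _ _ => h.
have := leq_mul (ltnW h) (ltnW h); lia.
Qed.

(** Inductively, l_{j+1} = N_j l_j <= N_j^2 <= N_{j+1}. *)
Lemma len_le_nwords r j : 6 <= r -> len r j <= nwords r j.
Proof.
move=> hr; elim: j => [|j IH]; first by apply: sq_le_exp2; lia.
apply: leq_trans (nwords_sq_le j hr); by rewrite /= leq_mul2l IH orbT.
Qed.

Lemma len_gt0 r j : 6 <= r -> 0 < len r j.
Proof.
move=> hr; elim: j => [|j IH] /=; first by rewrite muln_gt0; lia.
by rewrite muln_gt0 IH (leq_trans _ (nwords_ge64 j hr)).
Qed.

Lemma nwords_le_len r j : 6 <= r -> nwords r j <= len r j.+1.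
Proof. by move=> hr; rewrite leq_pmulr // len_gt0. Qed.

Lemma len_ltS r j : 6 <= r -> 2 * len r j <= len r j.+1.
Proof.
by move=> hr /=; rewrite leq_mul2r (leq_trans _ (nwords_ge64 j hr)) ?orbT.
Qed.

(** Makes the probabilities 2/l_j of the bad events summable. *)
Lemma exp2_le_len r j : 6 <= r -> 2 ^ j <= len r j.
Proof.
move=> hr; elim: j => [|j IH]; first exact: (@len_gt0 _ 0).
by rewrite expnS; apply: leq_trans (len_ltS _ hr); rewrite leq_mul2l.
Qed.

Lemma leq_len r i j : 6 <= r -> i <= j -> len r i <= len r j.
Proof.
move=> hr /subnK <-; elim: (j - i) => // k IH; rewrite addSn.
by apply: (leq_trans IH); apply: leq_trans (len_ltS _ hr); rewrite leq_pmull.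
Qed.

(** * Cutting words into blocks of equal length *)

Definition chunk (l k : nat) (w : seq bool) : seq bool := take l (drop (k * l) w).

Lemma nth_chunk b l k w t : t < l -> nth b (chunk l k w) t = nth b w (k * l + t).
Proof. by move=> h; rewrite nth_take // nth_drop. Qed.

Lemma size_chunk l k w : k.+1 * l <= size w -> size (chunk l k w) = l.
Proof. move=> h; rewrite size_takel // size_drop; nia. Qed.

Lemma size_flatten_const (l : nat) (ws : seq (seq bool)) :
  (forall w, w \in ws -> size w = l) -> size (flatten ws) = size ws * l.
Proof.
elim: ws => // w ws IH h; rewrite /= size_cat IH ?h ?mem_head //.
by move=> v hv; apply: h; rewrite in_cons hv orbT.
Qed.

Lemma chunk_flatten (l k : nat) (ws : seq (seq bool)) :
  (forall w, w \in ws -> size w = l) -> k < size ws ->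
  chunk l k (flatten ws) = nth [::] ws k.
Proof.
rewrite /chunk; elim: ws k => // w ws IH [|k] h hk /=.
  by rewrite mul0n drop0 take_size_cat ?h ?mem_head.
rewrite mulSn addnC -drop_drop.
have -> : drop l (w ++ flatten ws) = flatten ws by rewrite drop_size_cat ?h ?mem_head.
rewrite IH //; by move=> v hv; apply: h; rewrite in_cons hv orbT.
Qed.

(** * Counting the words of the next level by permutations *)

Section Permuted.
Variables (l : nat) (D : seq (seq bool)).
Hypotheses (D_uniq : uniq D) (D_size : forall w, w \in D -> size w = l).
Let N := size D.

(* P_j, with positions numbered from 0. *)
Definition movable (n : nat) : {set 'I_n} := [set i : 'I_n | Pset n i.+1].

Definition perm_word (pi : {perm 'I_N}) : seq bool :=
  flatten [seq nth [::] D (pi i) | i <- enum 'I_N].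

Lemma perm_word_blocks (pi : {perm 'I_N}) w :
  w \in [seq nth [::] D (pi i) | i <- enum 'I_N] -> size w = l.
Proof. by case/mapP => i _ ->; apply: D_size; exact: mem_nth. Qed.

Lemma size_perm_word pi : size (perm_word pi) = N * l.
Proof.
rewrite (size_flatten_const (l := l)); last exact: perm_word_blocks.
by rewrite size_map size_enum_ord.
Qed.

Lemma chunk_perm_word pi (k : 'I_N) : chunk l k (perm_word pi) = nth [::] D (pi k).
Proof.
rewrite chunk_flatten; last 1 first.
- by rewrite size_map size_enum_ord.
- by rewrite (nth_map k) ?size_enum_ord // nth_ord_enum.
exact: perm_word_blocks.
Qed.

Lemma chunk_perm_word_inj pi si (k : 'I_N) :
  chunk l k (perm_word pi) = chunk l k (perm_word si) -> pi k = si k.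
Proof.
by rewrite !chunk_perm_word => /eqP; rewrite nth_uniq // => /eqP/val_inj.
Qed.

Lemma perm_word_inj : injective perm_word.
Proof.
by move=> pi si h; apply/permP => k; apply: chunk_perm_word_inj; rewrite h.
Qed.

Lemma next_level_wordP w :
  next_level_word D w <-> exists2 pi, perm_on (movable N) pi & w = perm_word pi.
Proof.
split=> [[pi [h ->]]|[pi /fintype.subsetP h ->]]; exists pi => //.
  apply/fintype.subsetP => i; rewrite inE => hi; rewrite inE.
  by apply: contraR hi => /h ->.
split=> // i; apply: contraNeq => hi.
by have := h i; rewrite !inE => ->.
Qed.

Variable E : seq (seq bool).
Hypotheses (E_uniq : uniq E) (memE : forall w, w \in E <-> next_level_word D w).

Lemma count_next (a : pred (seq bool)) :
  count a E = #|[set pi | perm_on (movable N) pi && a (perm_word pi)]|.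
Proof.
have hp : perm_eq E [seq perm_word pi | pi in [set pi | perm_on (movable N) pi]].
  apply: uniq_perm => // [|w].
    by rewrite map_inj_uniq ?enum_uniq //; exact: perm_word_inj.
  apply/idP/mapP => [/memE/next_level_wordP[pi h ->]|[pi h ->]].
    by exists pi => //; rewrite mem_enum inE.
  by apply/memE/next_level_wordP; exists pi => //; move: h; rewrite mem_enum inE.
rewrite (seq.permP hp) count_map -size_filter cardE /enum_mem -filter_predI.
congr size; apply: eq_filter => pi /=; by rewrite !inE andbC.
Qed.

Lemma size_next : size E = #|movable N|`!.
Proof.
rewrite -(count_predT E) count_next -card_perm; apply: eq_card => pi.
by rewrite !inE andbT.
Qed.

(** Composing the permutation of v0 with one supported on the movable positions outside Q leaves the
    blocks at Q unchanged. *)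
Lemma count_next_ge (Q : {set 'I_N}) v0 : v0 \in E ->
  #|movable N :\: Q|`! <=
  count (fun v => [forall k in Q, chunk l k v == chunk l k v0]) E.
Proof.
move=> /memE/next_level_wordP[p0 h0 ->]; rewrite count_next -card_perm.
rewrite -[X in X <= _](card_imset _ (mulIg p0)); apply/subset_leq_card/fintype.subsetP => _ /imsetP[s hs ->].
move: hs; rewrite !inE => hs; apply/andP; split.
  by apply: perm_onM => //; apply: (fintype.subset_trans hs); exact: subsetDl.
apply/forallP => k; apply/implyP => kQ; rewrite !chunk_perm_word permM.
by rewrite (out_perm hs) // inE kQ.
Qed.

(** If p0 is the permutation of one such word, composing those of the others with its inverse gives
    permutations that fix Q and all immovable positions. *)
Lemma count_next_le (Q : {set 'I_N}) (a : pred (seq bool)) :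
  (forall v v' (k : 'I_N), v \in E -> v' \in E -> a v -> a v' -> k \in Q ->
     chunk l k v = chunk l k v') ->
  count a E <= #|movable N :\: Q|`!.
Proof.
move=> h; rewrite count_next.
set A := [set _ | _].
have inE' pi : perm_on (movable N) pi -> perm_word pi \in E.
  by move=> hpi; apply/memE/next_level_wordP; exists pi.
have [->|[p0]] := set_0Vmem A; first by rewrite cards0.
rewrite inE => /andP[h0 a0].
rewrite -card_perm -[X in X <= _](card_imset _ (mulIg p0^-1%g)).
apply/subset_leq_card/fintype.subsetP => _ /imsetP[s + ->].
rewrite !inE => /andP[hs as_].
apply/fintype.subsetP => k; rewrite !inE permM => hk.
have hk' : s k != p0 k by apply: contra hk => /eqP ->; rewrite permK.
apply/andP; split.
  apply: contra hk' => kQ; apply/eqP/chunk_perm_word_inj.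
  by apply: h => //; exact: inE'.
apply: contraR hk' => hk2.
have hk3 : k \notin movable N by rewrite inE.
by rewrite (out_perm hs hk3) (out_perm h0 hk3).
Qed.

End Permuted.

(** * Perfect squares among the block positions of a window *)

Lemma PsetP N k :
  reflect (k = 2 \/ exists i, [/\ 2 <= i, i * i <= N & k = i * i]) (Pset N k).
Proof.
apply: (iffP orP) => -[/eqP ->|]; [by left| | by left|].
  by case/existsP => i /and3P[h1 h2 /eqP ->]; right; exists i.
case=> i [h1 h2 ->]; right; apply/existsP.
have hi : i < N.+1 by nia.
by exists (Ordinal hi); rewrite h1 h2 eqxx.
Qed.

Lemma movable_image n (A : {set 'I_n}) (s : seq nat) :
  uniq s -> (forall k : nat, k \in s -> exists2 i : 'I_n, i \in A & i = k :> nat) ->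
  size s <= #|A|.
Proof.
move=> us h; rewrite cardE -(size_map val); apply: uniq_leq_size => // k /h[i hi <-].
by apply: map_f; rewrite mem_enum.
Qed.

Lemma image_movable n (A : {set 'I_n}) (s : seq nat) :
  (forall i : 'I_n, i \in A -> (i : nat) \in s) -> #|A| <= size s.
Proof.
move=> h; rewrite cardE -(size_map val); apply: uniq_leq_size.
  by rewrite map_inj_uniq ?enum_uniq //; exact: val_inj.
by move=> _ /mapP[i + ->]; rewrite mem_enum; exact: h.
Qed.

(** The predecessor is there because positions are numbered from 0; it sends 0^2 and 1^2 to the same
    value, whence 0 < a. *)
Lemma uniq_squares a m : 0 < a -> uniq [seq (i * i).-1 | i <- iota a m].
Proof.
move=> a0; rewrite map_inj_in_uniq ?iota_uniq // => i j.
rewrite !mem_iota; nia.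
Qed.

(** Position 2 takes the place of the missing square 1. *)
Lemma card_movable n : 4 <= n -> #|movable n| = isqrt n.
Proof.
move=> n4; have s2 : 2 <= isqrt n by exact: leq_isqrt.
have -> : isqrt n = size (1 :: [seq (i * i).-1 | i <- iota 2 (isqrt n).-1]).
  by rewrite /= size_map size_iota; lia.
have sq := isqrt_sq_le n.
apply/eqP; rewrite eqn_leq; apply/andP; split.
  apply: image_movable => i; rewrite inE => /PsetP [h|[m [m2 mn h]]].
    by rewrite in_cons; apply/orP; left; apply/eqP; lia.
  rewrite in_cons; apply/orP; right; apply/mapP; exists m; last by lia.
  by rewrite mem_iota m2; have := leq_isqrt mn; lia.
apply: movable_image => [|k].
  rewrite /= uniq_squares // andbT; apply/mapP => -[m].
  rewrite mem_iota; nia.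
rewrite in_cons => /orP[/eqP ->|/mapP[m]].
  have h : 1 < n by lia.
  by exists (Ordinal h) => //; rewrite inE; apply/PsetP; left.
rewrite mem_iota => /andP[m2 hm] ->.
have mn : m * m <= n by nia.
have h : (m * m).-1 < n by nia.
exists (Ordinal h) => //; rewrite inE; apply/PsetP; right; exists m; split => //=; nia.
Qed.

(** The window is [p, p+h). Its content determines the blocks inside it and is determined by the
    blocks that meet it; this gives an upper and a lower bound for the number of words sharing
    it. *)
Definition inside_window (l p h n : nat) : {set 'I_n} :=
  [set k : 'I_n | (p <= k * l) && (k.+1 * l <= p + h)].

Definition meets_window (l p h n : nat) : {set 'I_n} :=
  [set k : 'I_n | (k * l < p + h) && (p < k.+1 * l)].

(** Each square m^2 with A < m^2 <= B, except 1, is a movable position, so sqrt B - sqrt A is at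
    most about s. Multiplying by sqrt A + sqrt B <= 2 sqrt n bounds B - A, the number of whole
    blocks. *)
Lemma card_inside_window l p h n : 0 < l -> p + h <= n * l ->
  h <= l * ((#|movable n :&: inside_window l p h n| + 2) * (2 * isqrt n + 1) + 2).
Proof.
move=> l0 hn; set s := #|_|.
(* p / l rounded up and (p+h) / l rounded down: the blocks A, ..., B-1 lie inside the window. *)
set A := (p + l.-1) %/ l; set B := (p + h) %/ l.
have hA : A * l <= p + l.-1 by exact: leq_divM.
have hA' : p <= A * l.
  by have := ltn_ceil (p + l.-1) l0; rewrite -/A mulSn; lia.
have hB : B * l <= p + h by exact: leq_divM.
have hB' : p + h < B.+1 * l by exact: ltn_ceil.
have An : A <= n.
  by rewrite -ltnS -(ltn_pmul2r l0) mulSn; lia.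
have Bn : B <= n by rewrite -(leq_pmul2r l0); lia.
set a := isqrt A; set b := isqrt B.
(* The maximum with 1 leaves out m = 1, whose square is not in P_j. *)
have sb : b - maxn a 1 <= s.
  rewrite -(size_iota (maxn a 1).+1 (b - maxn a 1)) -(size_map (fun i => (i * i).-1)).
  apply: movable_image => [|k /mapP[m]]; first by rewrite uniq_squares.
  rewrite mem_iota => /andP[m1 m2] ->.
  have [ma m0 mb] : [/\ a < m, 1 < m & m <= b] by split; lia.
  have mA : A < m * m by have := lt_isqrt_sq A; rewrite -/a; nia.
  have mB : m * m <= B by have := isqrt_sq_le B; rewrite -/b; nia.
  have hm : (m * m).-1 < n by lia.
  have e : ((m * m).-1).+1 = m * m by lia.
  exists (Ordinal hm) => //; rewrite !inE /= e.
  apply/andP; split; first by apply/PsetP; right; exists m; split => //; lia.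
  apply/andP; split.
    by apply: (leq_trans hA'); rewrite leq_pmul2r //; lia.
  by apply: leq_trans hB; rewrite leq_pmul2r.
have aA : a * a <= A := isqrt_sq_le A.
have bB : B < b.+1 * b.+1 := lt_isqrt_sq B.
have an : a <= isqrt n by exact: isqrt_le.
have bn : b <= isqrt n by exact: isqrt_le.
have hBA : B <= A + (s + 2) * (2 * isqrt n + 1).
  have : b <= s + a + 1 by lia.
  clear -aA bB an bn; nia.
have : h <= (B + 2 - A) * l.
  have [BA|AB] := leqP (B + 2) A.
    have : (B + 2) * l <= A * l by rewrite leq_mul2r BA orbT.
    by rewrite mulnDl mulSn in hB' *; lia.
  by rewrite mulnBl mulnDl; rewrite mulSn in hB'; lia.
move=> /leq_trans; apply; rewrite mulnC leq_mul2l; apply/orP; right; lia.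
Qed.

(** As p >= n, the window starts about n / l blocks in or later, where consecutive squares are at
    least about 2 sqrt (n / l) apart. The 2 subtracted allows for position 2 and for counting both
    end squares; the bound is squared to stay in the naturals. *)
Lemma card_meets_window l p h n : 0 < l -> n <= p ->
  4 * (#|movable n :&: meets_window l p h n| - 2) ^ 2 * (n * l) <= (h + l) ^ 2.
Proof.
move=> l0 hp; set s := #|_|.
set A := p %/ l; set B := ((p + h).-1 %/ l).+1.
have hA : p < A.+1 * l by exact: ltn_ceil.
have hB : B * l <= (p + h).-1 + l by rewrite /B mulSn addnC leq_add2r leq_divM.
have hB' : (p + h).-1 < B * l by exact: ltn_ceil.
set a := (isqrt A).+1; set b := isqrt B.
have aA : A < a * a := lt_isqrt_sq A.
have bB : b * b <= B := isqrt_sq_le B.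
have ss : s <= 1 + (b.+1 - a).
  have -> : 1 + (b.+1 - a) = size (1 :: [seq (i * i).-1 | i <- iota a (b.+1 - a)]).
    by rewrite /= size_map size_iota.
  apply: image_movable => k; rewrite !inE => /andP[/PsetP[k2|[m [m2 mn km]]] /andP[k1 pk]].
    by apply/orP; left; apply/eqP; lia.
  apply/orP; right; apply/mapP; exists m; last by lia.
  rewrite km in pk.
  have mA : A < m * m.
    by rewrite -(ltn_pmul2r l0); apply: leq_ltn_trans pk; exact: leq_divM.
  have mB : m * m <= B.
    by rewrite -km -ltnS -(ltn_pmul2r l0) ltn_mul2r l0 /= ltnS; rewrite -(ltn_pmul2r l0); lia.
  have am : a <= m by have := isqrt_sq_le A; rewrite /a; nia.
  have mb : m <= b by exact: leq_isqrt.
  rewrite mem_iota; lia.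
have [ba|ab] := leqP b a.
  have -> : s - 2 = 0 by lia.
  by rewrite muln0 mul0n.
have [d hd] : exists d, b = a + d by exists (b - a); lia.
have sd : s - 2 <= d by lia.
have h1 : d * (2 * a) * l <= h + l.
  have : A.+1 + d * (2 * a) <= B by clear -aA bB hd; subst b; nia.
  by move=> hh; have := leq_mul hh (leqnn l); rewrite mulnDl mulSn in hA *; lia.
have h2 : n <= a * a * l.
  by apply: (leq_trans hp); apply: (leq_trans (ltnW hA)); rewrite leq_mul2r aA orbT.
have h3 : 4 * d ^ 2 * (n * l) <= (h + l) ^ 2.
  apply: (@leq_trans ((d * (2 * a) * l) ^ 2)); last by rewrite leq_exp2r.
  have -> : (d * (2 * a) * l) ^ 2 = 4 * d ^ 2 * (a * a * l * l) by rewrite !expnS !expn0; lia.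
  by rewrite leq_mul2l leq_mul2r h2 !orbT.
by apply: leq_trans h3; rewrite leq_mul2r leq_mul2l leq_sqr sd !orbT.
Qed.

(** * Windows of words and of bi-infinite sequences *)

Lemma nth_window b p h (w : seq bool) t : t < h ->
  nth b (take h (drop p w)) t = nth b w (p + t).
Proof. by move=> h1; rewrite nth_take // nth_drop. Qed.

Lemma window_chunk l p h n (v w : seq bool) (k : 'I_n) :
  k \in inside_window l p h n ->
  take h (drop p v) = take h (drop p w) -> chunk l k v = chunk l k w.
Proof.
rewrite inE => /andP[h1 h2] e.
have chunkE u : chunk l k u = take l (drop (k * l - p) (take h (drop p u))).
  rewrite /chunk -[h in RHS](@subnK (k * l - p)); last by nia.
  rewrite -take_drop drop_drop subnK // take_takel //; nia.
by rewrite !chunkE e.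
Qed.

Lemma chunk_window l p h n (v w : seq bool) : 0 < l ->
  size v = n * l -> size w = n * l -> p + h <= n * l ->
  (forall k : 'I_n, k \in meets_window l p h n -> chunk l k v = chunk l k w) ->
  take h (drop p v) = take h (drop p w).
Proof.
move=> l0 sv sw hn e.
have sz u : size u = n * l -> size (take h (drop p u)) = h.
  by move=> su; rewrite size_takel // size_drop su; lia.
apply: (@eq_from_nth _ true) => [|t]; rewrite ?sz // => th.
rewrite !nth_window // (divn_eq (p + t) l).
set k := _ %/ l; have tl : (p + t) %% l < l by rewrite ltn_mod.
have dv := divn_eq (p + t) l; rewrite -/k in dv.
have kn : k < n by rewrite -(ltn_pmul2r l0); lia.
have := congr1 (fun u => nth true u ((p + t) %% l)) (e (Ordinal kn) _).
rewrite /= !nth_chunk //; apply; rewrite inE /= mulSn; lia.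
Qed.

Lemma int_divP (l : nat) (z : int) : 0 < l ->
  exists (q : int) (k : nat), k < l /\ z = (k%:Z + q * l%:Z)%R.
Proof.
move=> l0; have lz : (l%:Z != 0)%R by lia.
have l1 : (0 < l%:Z)%R by lia.
have e := divz_eq z l%:Z; have h0 := modz_ge0 z lz; have h1 := ltz_pmod z l1.
exists (z %/ l%:Z)%Z, `|(z %% l%:Z)%Z|%N; split; first by lia.
rewrite {1}e; lia.
Qed.

Lemma size_subword x m n : size (subword x m n) = n.
Proof. by rewrite size_mkseq. Qed.

Lemma nth_subword b x m n i : i < n -> nth b (subword x m n) i = x (m + i%:Z)%R.
Proof. by move=> h; rewrite nth_mkseq. Qed.

Lemma window_subword x m n p h : p + h <= n ->
  take h (drop p (subword x m n)) = subword x (m + p%:Z)%R h.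
Proof.
move=> hn; have s : size (take h (drop p (subword x m n))) = h.
  by rewrite size_takel // size_drop size_subword; lia.
apply: (@eq_from_nth _ true) => [|t]; rewrite s ?size_subword // => th.
rewrite nth_window // !nth_subword; [congr x; lia | lia | lia].
Qed.

Lemma chunk_subword x m n l k : k.+1 * l <= n ->
  chunk l k (subword x m n) = subword x (m + (k * l)%:Z)%R l.
Proof. by move=> h; apply: window_subword; rewrite addnC -mulSn. Qed.

Lemma chunk_chunk l t a b w : b < t -> a.+1 * (t * l) <= size w ->
  chunk l b (chunk (t * l) a w) = chunk l (a * t + b) w.
Proof.
move=> bt hs; have hb : b.+1 * l <= t * l by rewrite leq_mul2r bt orbT.
have {}hb : l + b * l <= t * l by rewrite -mulSn.
have e : t * l = t * l - b * l + b * l by lia.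
rewrite /chunk [X in drop _ (take X _)]e.
rewrite -take_drop drop_drop take_takel; last by lia.
by congr (take _ (drop _ _)); rewrite mulnDl mulnA addnC.
Qed.

Lemma eq_subword x m m' n (W : seq (seq bool)) : m = m' ->
  subword x m n \in W -> subword x m' n \in W.
Proof. by move->. Qed.

(** * Parsing the points of X into blocks *)

Section Construction.
Variables (r : nat) (C : nat -> seq (seq bool)).
Hypotheses (hr : 6 <= r) (hC : marker_construction r C).

Lemma memCS j w : w \in C j.+1 <-> next_level_word (C j) w.
Proof. by have [_ h _] := hC.2 j; exact: h. Qed.

Lemma uniqC j : uniq (C j).
Proof. by case: j => [|j]; [have [] := hC.1 | have [] := hC.2 j]. Qed.

(** The two facts go together: counting level j+1 by permutations uses the common length of the
    words of level j. *)
Lemma sizesC j : (forall w, w \in C j -> size w = len r j) /\ size (C j) = nwords r j.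
Proof.
elim: j => [|j [IHw IHs]].
  by have [_ sC wC] := hC.1; split=> // w /wC [].
split=> [w /memCS/next_level_wordP[pi _ ->]|].
  by rewrite (size_perm_word IHw) IHs.
rewrite (size_next (uniqC j) IHw (uniqC j.+1) (@memCS j)) card_movable IHs //.
by apply: leq_trans (nwords_ge64 j hr).
Qed.

Lemma size_wordC j w : w \in C j -> size w = len r j.
Proof. exact: (sizesC j).1. Qed.

Lemma sizeC j : size (C j) = nwords r j.
Proof. exact: (sizesC j).2. Qed.

Lemma chunk_mem j w k : w \in C j.+1 -> k < nwords r j -> chunk (len r j) k w \in C j.
Proof.
move=> /memCS/next_level_wordP[pi _ ->]; rewrite -sizeC => hk.
by rewrite (chunk_perm_word (@size_wordC j) pi (Ordinal hk)) mem_nth.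
Qed.

Lemma chunk_surj j w v : w \in C j.+1 -> v \in C j ->
  exists2 k, k < nwords r j & chunk (len r j) k w = v.
Proof.
move=> /memCS/next_level_wordP[pi _ ->] hv.
have hi : index v (C j) < size (C j) by rewrite index_mem.
exists (pi^-1%g (Ordinal hi)); first by rewrite -sizeC.
by rewrite (chunk_perm_word (@size_wordC j)) permKV /= nth_index.
Qed.

Lemma chunk_inj j w k k' : w \in C j.+1 -> k < nwords r j -> k' < nwords r j ->
  chunk (len r j) k w = chunk (len r j) k' w -> k = k'.
Proof.
move=> /memCS/next_level_wordP[pi _ ->]; rewrite -sizeC => hk hk'.
rewrite (chunk_perm_word (@size_wordC j) pi (Ordinal hk)).
rewrite (chunk_perm_word (@size_wordC j) pi (Ordinal hk')) => /eqP.
by rewrite nth_uniq ?uniqC // => /eqP/val_inj/perm_inj[].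
Qed.

Lemma nwords_gt0 j : 0 < nwords r j.
Proof. exact: leq_trans (nwords_ge64 j hr). Qed.

(* Position 1 is not in P_j: u_1 is the marker that makes the next level
   recognizable. *)
Lemma chunk0 j w : w \in C j.+1 -> chunk (len r j) 0 w = nth [::] (C j) 0.
Proof.
move=> /memCS/next_level_wordP[pi h ->].
have hk : 0 < size (C j) by rewrite sizeC nwords_gt0.
rewrite (chunk_perm_word (@size_wordC j) pi (Ordinal hk)) (out_perm h) //.
by rewrite inE; apply/PsetP => /= -[//|[i [i2 _ e]]]; nia.
Qed.

Definition block_parse j (x : config) (p : int) :=
  forall q : int, subword x (p + q * (len r j)%:Z)%R (len r j) \in C j.

Lemma parse_down j x p : block_parse j.+1 x p -> block_parse j x p.
Proof.
move=> h q; have [a [k [kn ->]]] := int_divP q (nwords_gt0 j).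
have := chunk_mem (h a) kn; rewrite chunk_subword; last by rewrite /= leq_mul2r kn orbT.
by apply: eq_subword; rewrite /= !PoszM; lia.
Qed.

Lemma wordC_chunks J j w : j <= J -> w \in C J ->
  exists2 t, size w = t * len r j & forall k, k < t -> chunk (len r j) k w \in C j.
Proof.
move=> /subnK <-; elim: (J - j) w => [|d IH] w hw.
  exists 1; first by rewrite mul1n (size_wordC hw).
  move=> k; rewrite ltnS leqn0 => /eqP ->.
  by rewrite /chunk mul0n drop0 take_oversize // (size_wordC hw).
have sw := size_wordC hw; rewrite addSn /= in sw.
have n0 := nwords_gt0 (d + j).
have [t st _] := IH _ (chunk_mem hw n0).
have {}st : len r (d + j) = t * len r j.
  by rewrite -st size_chunk // mul1n sw leq_pmull.
exists (nwords r (d + j) * t); first by rewrite sw st mulnA.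
move=> k hk.
have t0 : 0 < t by case: t hk {st} => //; rewrite muln0.
(* A word of level d+j has t blocks of level j, so block k of w is block k mod t inside its block k
   / t of level d+j. *)
have an : k %/ t < nwords r (d + j) by rewrite ltn_divLR.
have bt : k %% t < t by rewrite ltn_mod.
have [t' st' ht'] := IH _ (chunk_mem hw an).
rewrite size_chunk in st'; last by rewrite sw leq_mul2r an orbT.
have l0 := len_gt0 j hr.
have tt : t' = t by apply/eqP; rewrite -(eqn_pmul2r l0) -st' st.
have := ht' (k %% t); rewrite tt => /(_ bt).
by rewrite st chunk_chunk // -?divn_eq // -st sw leq_mul2r an orbT.
Qed.

(** The offset p is the position of the start of w in the coordinates of x, modulo l_j. *)
Lemma local_parse j J x m n w : j <= J -> w \in C J -> infix (subword x m n) w ->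
  exists2 p, p < len r j & forall q : int,
    (m <= p%:Z + q * (len r j)%:Z)%R ->
    (p%:Z + q * (len r j)%:Z + (len r j)%:Z <= m + n%:Z)%R ->
    subword x (p%:Z + q * (len r j)%:Z)%R (len r j) \in C j.
Proof.
move=> jJ hw /infixP[s1 [s2 ew]]; have l0 := len_gt0 j hr.
have [t st ht] := wordC_chunks jJ hw.
set a := size s1; set l := len r j.
have [c [p [pl hc]]] := int_divP (m - a%:Z)%R l0.
rewrite -/l in pl hc; exists p => //.
move=> q q1 q2.
have hk : (0 <= q - c)%R.
  have : (0 <= (q - c) * l%:Z)%R by lia.
  by rewrite GRing.mulrC Num.Theory.pmulr_rge0 //; lia.
have [k ek] : exists k : nat, (q - c)%R = Posz k by exists `|(q - c)%R|%N; lia.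
have kl : (Posz (k * l) = p%:Z + q * l%:Z - m + a%:Z)%R.
  by rewrite PoszM -ek; lia.
have sw : size w = a + n + size s2 by rewrite ew !size_cat size_subword addnA.
have kt : k < t by rewrite -(ltn_pmul2r l0) -st sw -/l; lia.
have := ht k kt; rewrite -/l /chunk ew.
rewrite drop_cat ltnNge (_ : size s1 <= k * l) /=; last by rewrite -/a; lia.
rewrite -/a drop_cat size_subword; case: ltnP => h3; last by lia.
rewrite takel_cat; last by rewrite size_drop size_subword; lia.
by rewrite window_subword; [apply: eq_subword; lia | lia].
Qed.

(** A finite form of compactness: there are only l_j offsets, and if each failed at some block, a
    window containing all these blocks would contradict [local_parse]. *)
Lemma parse_exists j x : marker_shift C x -> exists2 p, p < len r j & block_parse j x (Posz p).
Proof.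
move=> hx; set l := len r j.
have l0 : 0 < l by exact: len_gt0.
apply: boolp.contrapT => hno.
have /boolp.choice[f hf] : forall p : 'I_l, exists q : int,
    subword x (Posz p + q * l%:Z)%R l \notin C j.
  move=> p; apply: boolp.contrapT => hq; apply: hno; exists p => // q.
  by apply/negPn/negP => h; apply: hq; exists q.
set K := (\sum_(p < l) `|f p|) * l + 2 * l.
have [J [w hw hi]] := hx (- K%:Z)%R (2 * K).
(* K >= 2 l_j, so the window is longer than the words of all levels below j. *)
have jJ : j <= J.
  rewrite leqNgt; apply/negP => Jj.
  have := size_infix hi; rewrite size_subword (size_wordC hw).
  have := leq_len hr Jj; have := len_ltS J hr; have := len_gt0 J hr.
  rewrite /K -/l; lia.
have [p pl h] := local_parse jJ hw hi.
have fK : `|f (Ordinal pl)| * l + 2 * l <= K.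
  by rewrite leq_add2r leq_mul2r (bigD1 (Ordinal pl)) //= leq_addr orbT.
have := hf (Ordinal pl); rewrite h //=; move: (f _) fK; rewrite -/l => q qK.
  have : (- (`|q| * l)%:Z <= q * l%:Z)%R by rewrite PoszM; nia.
  lia.
have : (q * l%:Z <= (`|q| * l)%:Z)%R by rewrite PoszM; nia.
rewrite -/l in pl; lia.
Qed.

Lemma base_nth w i : w \in C 0 -> i < len r 0 ->
  (i = 0 -> nth true w 0 = false /\ nth true w 1 = false /\ nth true w 2 = true) /\
  (0 < i -> i.+1 < len r 0 -> nth true w i = false -> nth true w i.+1 = true).
Proof.
have [_ _ wC] := hC.1 => /wC [sw tw hw] il; split=> [_|i0 i1 n0].
  have tk k : k < 3 -> nth true w k = nth true [:: false; false; true] k.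
    by move=> k3; rewrite -tw nth_take.
  by rewrite !tk.
case E : (nth true w i.+1) => //; case: (hw i i0) => //; by rewrite sw.
Qed.

(* At level 0 the blocks start exactly at the occurrences of 001; at level j+1,
   exactly at those of the first word of level j. *)
Lemma recognizability j x p i : block_parse j x p -> subword x i (len r j) \in C j ->
  exists q : int, i = (p + q * (len r j)%:Z)%R.
Proof.
elim: j i => [|j IH] i hp hi.
  have l3 : 36 <= len r 0 by rewrite /= (leq_mul hr hr).
  have [q [t [tl e]]] := int_divP (i - p)%R (len_gt0 0 hr).
  have [q0 _] := base_nth hi (len_gt0 0 hr).
  have {q0} [] := q0 erefl; rewrite !nth_subword; try lia.
  move=> x0 [x1 x2].
  have [t0|tpos] := posnP t; first by exists q; lia.
  have [t1|t1] := ltnP t.+1 (len r 0).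
    have [_ /(_ tpos t1)] := base_nth (hp q) tl.
    rewrite !nth_subword // => h; exfalso.
    have : x (p + q * (len r 0)%:Z + t%:Z)%R = false by rewrite -x0; congr x; lia.
    move=> /h; rewrite (_ : (_ + _)%R = (i + 1%:Z)%R) ?x1 //; lia.
  (* Here i is the last letter of its block, so i+2 is the second letter of the next one, a 0,
     against the 1 that ends 001. *)
  have [q0 _] := base_nth (hp (q + 1)%R) (len_gt0 0 hr).
  have {q0} [] := q0 erefl; rewrite !nth_subword; try lia.
  move=> _ [+ _]; rewrite (_ : (_ + _)%R = (i + 2%:Z)%R) ?x2 //; lia.
have n0 := nwords_gt0 j.
have hi0 : chunk (len r j) 0 (subword x i (len r j.+1)) \in C j by exact: chunk_mem.
have e0 := chunk0 hi; move: hi0 e0.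
rewrite chunk_subword; last by rewrite mul1n leq_pmull.
rewrite mul0n GRing.addr0 => hi0 e0.
have [q e] := IH _ (parse_down hp) hi0.
have [a [k [kn eq]]] := int_divP q n0.
(* By induction i is a block boundary of level j; the block there is u_1, which occurs only once in
   a word of level j+1, at its start. *)
have hk : chunk (len r j) k (subword x (p + a * (len r j.+1)%:Z)%R (len r j.+1)) =
          chunk (len r j) 0 (subword x (p + a * (len r j.+1)%:Z)%R (len r j.+1)).
  rewrite (chunk0 (hp a)) -e0 chunk_subword; last by rewrite leq_mul2r kn orbT.
  by congr subword; rewrite e eq /= !PoszM; lia.
have k0 := chunk_inj (hp a) kn n0 hk.
by exists a; rewrite e eq k0 /= PoszM; lia.
Qed.

Lemma count_window_le j p h u : p + h <= len r j.+1 ->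
  count (fun v => take h (drop p v) == u) (C j.+1) <=
  (isqrt (nwords r j) -
   #|movable (nwords r j) :&: inside_window (len r j) p h (nwords r j)|)`!.
Proof.
move=> hp; have s4 : 4 <= nwords r j by apply: leq_trans (nwords_ge64 j hr).
rewrite -(card_movable s4) -cardsD -!sizeC.
apply: (count_next_le (uniqC j) (@size_wordC j) (uniqC j.+1) (@memCS j)) => v v' k _ _.
by move=> /eqP e /eqP e' hk; apply: (window_chunk hk); rewrite e e'.
Qed.

Lemma count_window_ge j p n v0 : v0 \in C j.+1 -> p + n <= len r j.+1 ->
  (isqrt (nwords r j) -
   #|movable (nwords r j) :&: meets_window (len r j) p n (nwords r j)|)`! <=
  count (fun v => take n (drop p v) == take n (drop p v0)) (C j.+1).
Proof.
move=> hv hp; have s4 : 4 <= nwords r j by apply: leq_trans (nwords_ge64 j hr).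
have l0 := len_gt0 j hr.
rewrite -(card_movable s4) -cardsD; move: hp; rewrite /= -!sizeC => hp.
have := count_next_ge (uniqC j) (@size_wordC j) (uniqC j.+1) (@memCS j)
  (meets_window (len r j) p n (size (C j))) hv.
move=> /leq_trans; apply; rewrite -!size_filter.
apply: uniq_leq_size; first by rewrite filter_uniq ?uniqC.
move=> v; rewrite !mem_filter => /andP[/forallP hk vC]; rewrite vC andbT.
have sz w : w \in C j.+1 -> size w = size (C j) * len r j.
  by move=> /size_wordC ->; rewrite sizeC.
apply/eqP/(chunk_window l0 (sz _ vC) (sz _ hv) hp) => k kw.
by apply/eqP; have /implyP := hk k; apply.
Qed.

End Construction.

From mathcomp Require Import all_classical all_reals all_analysis.
From mathcomp Require Import ring lra.
Import Order.TTheory GRing.Theory Num.Theory.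
Local Open Scope classical_set_scope.
Local Open Scope ring_scope.

(** * Measure of cylinders *)

(** Taking a set of words lets the same events describe a single word, a whole level, or the words
    with a prescribed window. *)
Definition occ (m : int) (n : nat) (W : set (seq bool)) : set shift_space :=
  [set y | W (subword y m n)].

Lemma measurable_occ m n W : measurable (occ m n W).
Proof.
elim: n W => [|n IH] W.
  have [w|w] := pselect (W [::]).
    rewrite (_ : occ _ _ _ = setT); first exact: measurableT.
    by rewrite -subTset => y _; rewrite /occ /= /subword.
  rewrite (_ : occ _ _ _ = set0); first exact: measurable0.
  by rewrite -subset0 => y.
have mX b : measurable [set y : shift_space | y (m + n%:Z) = b].
  by apply: sub_sigma_algebra; exists (m + n%:Z), b.
rewrite (_ : occ _ _ _ =
  ([set y : shift_space | y (m + n%:Z) = true] `&` occ m n [set w | W (rcons w true)]) `|`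
  ([set y : shift_space | y (m + n%:Z) = false] `&` occ m n [set w | W (rcons w false)])).
  by apply: measurableU; apply: measurableI.
apply/seteqP; split => [y|y]; rewrite /occ /= /subword mkseqS.
  by case: (y (m + n%:Z)) => h; [left | right].
by case=> -[-> ].
Qed.

Lemma measurable_marker_shift C : measurable (marker_shift C : set shift_space).
Proof.
pose L := [set u : seq bool | exists j, exists2 w, w \in C j & infix u w].
(* A countable intersection over the pairs (m, n); indices that code no pair contribute the whole
   space. *)
rewrite (_ : marker_shift C =
  \bigcap_(k in [set: nat]) (oapp (fun mn : int * nat => occ mn.1 mn.2 L) setT (unpickle k))).
  apply: bigcap_measurable => [|k _]; first by exists 0%N.
  by case: (unpickle k) => [[m n]|] /=; [exact: measurable_occ | exact: measurableT].
apply/seteqP; split => [y h k _|y h m n].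
  by case: (unpickle k) => [[m n]|] //=; exact: h.
by have := h (pickle (m, n)) I; rewrite pickleK.
Qed.

(** * Finite additivity up to the null set outside X *)

Section FullMeasure.
Variables (R : realType) (d : measure_display) (T : measurableType d).
Variables (mu : probability T R) (X : set T).
Hypotheses (mX : measurable X) (hmu : mu X = 1%E).

Definition pr (A : set T) : R := fine (mu A).

Lemma pr_EFin A : measurable A -> mu A = (pr A)%:E.
Proof. by move=> mA; rewrite fineK // fin_num_measure. Qed.

Lemma pr_ge0 A : 0 <= pr A.
Proof. by apply: fine_ge0; exact: measure_ge0. Qed.

Lemma pr_setT : pr setT = 1.
Proof. by rewrite /pr probability_setT. Qed.

Lemma pr_le A B : measurable A -> measurable B -> A `&` X `<=` B -> pr A <= pr B.
Proof.
move=> mA mB AB.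
pose Xc : set T := ~` X.
have mXC : measurable Xc by exact: measurableC.
have x0 : mu Xc = 0%E by rewrite probability_setC // hmu subee.
rewrite -lee_fin -!pr_EFin //.
have : (mu A <= mu (B `|` Xc))%E.
  apply: le_measure; rewrite ?inE //; first exact: measurableU.
  by move=> y Ay; have [h|h] := pselect (X y); [left; apply: AB | right].
move=> /le_trans; apply.
have : (mu (B `|` Xc) <= mu B + mu Xc)%E by exact: measureU2.
by rewrite x0 adde0.
Qed.

Lemma pr_setU A B : measurable A -> measurable B -> pr (A `|` B) <= pr A + pr B.
Proof.
move=> mA mB; rewrite -lee_fin EFinD -!pr_EFin //; last exact: measurableU.
exact: measureU2.
Qed.

Lemma pr_cover (I : eqType) (s : seq I) (A : I -> set T) B :
  (forall i, measurable (A i)) -> measurable B ->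
  (forall y, X y -> B y -> exists2 i, i \in s & A i y) ->
  pr B <= \sum_(i <- s) pr (A i).
Proof.
move=> mA; elim: s B => [|i s IH] B mB h.
  rewrite big_nil; apply: (le_trans (pr_le mB measurable0 _)).
    by move=> y [By /h -/(_ By)[]].
  by rewrite /pr measure0.
rewrite big_cons.
have mBA : measurable (B `\` A i) by exact: measurableD.
apply: (@le_trans _ _ (pr (A i) + pr (B `\` A i))).
  apply: (le_trans _ (pr_setU _ _)) => //; apply: pr_le => //; first exact: measurableU.
  by move=> y [By _]; have [ha|ha] := pselect (A i y); [left | right].
rewrite lerD2l; apply: IH => // y Xy [/= By nA].
have [k] := h y Xy By; rewrite in_cons => /orP[/eqP -> //|ks Ak].
by exists k.
Qed.

Lemma pr_pack (I : eqType) (s : seq I) (A : I -> set T) B :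
  (forall i, measurable (A i)) -> measurable B -> uniq s ->
  (forall i y, i \in s -> X y -> A i y -> B y) ->
  (forall i k y, i \in s -> k \in s -> X y -> A i y -> A k y -> i = k) ->
  \sum_(i <- s) pr (A i) <= pr B.
Proof.
move=> mA; elim: s B => [|i s IH] B mB /= us hB hd; first by rewrite big_nil pr_ge0.
move: us => /andP[is_ us]; rewrite big_cons.
have mBA : measurable (B `\` A i) by exact: measurableD.
have : \sum_(k <- s) pr (A k) <= pr (B `\` A i).
  apply: IH => // [k y ks Xy Ak|k l y ks ls]; last first.
    by apply: hd; rewrite in_cons ?ks ?ls orbT.
  split; first by apply: (hB k) => //; rewrite in_cons ks orbT.
  move=> Ai; have ik : i = k by apply: (hd i k y) => //; rewrite ?mem_head // in_cons ks orbT.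
  by rewrite ik ks in is_.
rewrite -(lerD2l (pr (A i))) => /le_trans; apply.
have mU : measurable (A i `|` (B `\` A i)) by exact: measurableU.
have e : mu (A i `|` (B `\` A i)) = (mu (A i) + mu (B `\` A i))%E.
  by apply: measureU => //; rewrite -subset0 => y [? []].
rewrite !pr_EFin // -EFinD in e; case: e => <-.
apply: pr_le => // y [[Ai|[] //] Xy].
by apply: (hB i) => //; rewrite mem_head.
Qed.

End FullMeasure.

(** * Cylinder measures from shift invariance *)

Section Measure.
Variables (R : realType) (r : nat) (C : nat -> seq (seq bool)).
Hypotheses (hr : (6 <= r)%N) (hC : marker_construction r C).
Variable mu : probability shift_space R.
Hypotheses (hmu : mu (marker_shift C) = 1%E)
  (hinv : forall A : set shift_space, measurable A -> mu (sshift @^-1` A) = mu A).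

Local Notation X := (marker_shift C : set shift_space).

Let mX : measurable X. Proof. exact: measurable_marker_shift. Qed.

Lemma pr_occ m n W : pr mu (occ m n W) = pr mu (occ 0 n W).
Proof.
have hs k : pr mu (occ (k + 1) n W) = pr mu (occ k n W).
  have := hinv (measurable_occ k n W).
  rewrite /pr => <-.
  congr (fine (mu _)); apply/seteqP.
  have e y : subword (sshift y) k n = subword y (k + 1) n.
    by apply: eq_mkseq => i; rewrite /sshift; congr y; lia.
  by split => y; rewrite /occ /= e.
elim/int_rec: m => [//|k <-|k <-].
  by rewrite -[RHS]hs (_ : k%:Z + 1 = k.+1%:Z) //; lia.
by rewrite -[LHS]hs (_ : - k.+1%:Z + 1 = - k%:Z) //; lia.
Qed.

(** By recognizability no two blocks of level j start less than l_j apart, so l_j consecutive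
    translates of the event are disjoint on X. *)
Lemma pr_block j : pr mu (occ 0 (len r j) [set` C j]) * (len r j)%:R <= 1.
Proof.
rewrite -[leRHS](pr_setT mu); have -> : pr mu (occ 0 (len r j) [set` C j]) * (len r j)%:R =
    \sum_(i <- iota 0 (len r j)) pr mu (occ i%:Z (len r j) [set` C j]).
  under eq_bigr do rewrite pr_occ.
  by rewrite big_const_seq count_predT size_iota iter_addr_0 mulr_natr.
apply: (pr_pack mX hmu) => //; first by move=> i; exact: measurable_occ.
  exact: iota_uniq.
move=> i k y; rewrite !mem_iota => il kl Xy hi hk.
have [p _ hp] := parse_exists hr hC j Xy.
have [a ha] := recognizability hr hC hp hi.
have [b hb] := recognizability hr hC hp hk.
have : a = b by nia.
by move=> ab; move: ha; rewrite ab -hb => -[].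
Qed.

Lemma block_starts j y : X y -> forall m : int,
  exists i : nat, [/\ (i < len r j)%N, block_parse r C j y (m - i%:Z) & subword y (m - i%:Z) (len r j) \in C j].
Proof.
move=> Xy m; have [p _ hp] := parse_exists hr hC j Xy.
have [q [i [il e]]] := int_divP (m - p%:Z)%R (len_gt0 j hr).
have hm : m - i%:Z = p%:Z + q * (len r j)%:Z by lia.
exists i; split => //; last by rewrite hm; exact: hp.
by move=> q'; have := hp (q + q'); apply: eq_subword; rewrite hm; lia.
Qed.

(** Every window of length 2 l_{j+1} contains a whole block of level j+1, and that block contains
    v. *)
Lemma pr_word_ge j v : v \in C j ->
  1 <= pr mu (occ 0 (len r j) [set v]) * (2 * len r j.+1)%:R.
Proof.
move=> vC; rewrite -[X in X <= _](pr_setT mu).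
have -> : pr mu (occ 0 (len r j) [set v]) * (2 * len r j.+1)%:R =
    \sum_(i <- iota 0 (2 * len r j.+1)) pr mu (occ i%:Z (len r j) [set v]).
  under eq_bigr do rewrite pr_occ.
  by rewrite big_const_seq count_predT size_iota iter_addr_0 mulr_natr.
apply: (pr_cover mX hmu) => //; first by move=> i; exact: measurable_occ.
move=> y Xy _; have [i [il _ hi]] := block_starts j.+1 Xy (len r j.+1)%:Z.
have [k kn hk] := chunk_surj hr hC hi vC.
have kl : (k.+1 * len r j <= nwords r j * len r j)%N by rewrite leq_mul2r kn orbT.
exists (len r j.+1 - i + k * len r j)%N.
  by rewrite mem_iota /=; have := len_gt0 j hr; rewrite mulSn in kl; rewrite /= in il *; lia.
rewrite chunk_subword // in hk; rewrite /occ /= -hk; congr subword; rewrite /= in il *; lia.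
Qed.

(** By recognizability, an occurrence of v is a level-j block, at some place k of its block of level
    j+1. The sets W k are disjoint since v occurs once per block, so their probabilities add up to
    at most that of a block start. *)
Lemma pr_word_le j v : v \in C j ->
  pr mu (occ 0 (len r j) [set v]) * (len r j.+1)%:R <= 1.
Proof.
move=> vC; apply: le_trans (pr_block j.+1); rewrite ler_wpM2r //.
pose W k := [set w | w \in C j.+1 /\ chunk (len r j) k w = v].
apply: (@le_trans _ _ (\sum_(k <- iota 0 (nwords r j)) pr mu (occ 0 (len r j.+1) (W k)))).
  rewrite (eq_bigr (fun k => pr mu (occ (- (k * len r j)%:Z) (len r j.+1) (W k)))); last first.
    by move=> k _; rewrite pr_occ.
  apply: (pr_cover mX hmu) => [i||]; [exact: measurable_occ | exact: measurable_occ |].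
  move=> y Xy hv; have [p _ hp] := parse_exists hr hC j.+1 Xy.
  have hv' : subword y 0 (len r j) \in C j by rewrite hv.
  have [q hq] := recognizability hr hC (parse_down hr hC hp) hv'.
  have [a [k [kn e]]] := int_divP q (nwords_gt0 hr j).
  have hb : subword y (- (k * len r j)%:Z) (len r j.+1) \in C j.+1.
    by have := hp a; apply: eq_subword; rewrite e /= in hq *; rewrite !PoszM; lia.
  exists k; first by rewrite mem_iota.
  rewrite /occ /=; split => //; rewrite chunk_subword; last by rewrite leq_mul2r kn orbT.
  by rewrite addNr.
apply: (pr_pack mX hmu) => [i||||]; [exact: measurable_occ | exact: measurable_occ | exact: iota_uniq | |].
  by move=> i y _ _ [].
move=> i k y; rewrite !mem_iota => il kl Xy [h1 h2] [h3 h4].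
by apply: (chunk_inj hr hC h1) => //; rewrite h2 h4.
Qed.

Lemma pr_words_le j (a : pred (seq bool)) :
  pr mu (occ 0 (len r j) [set w | w \in C j /\ a w]) * (len r j.+1)%:R <= (count a (C j))%:R.
Proof.
have l0 : 0 < (len r j.+1)%:R :> R by rewrite ltr0n len_gt0.
rewrite -ler_pdivlMr //.
apply: (@le_trans _ _ (\sum_(v <- [seq v <- C j | a v]) pr mu (occ 0 (len r j) [set v]))).
  apply: (pr_cover mX hmu) => [i||]; [exact: measurable_occ | exact: measurable_occ |].
  move=> y Xy [h1 h2]; exists (subword y 0 (len r j)) => //.
  by rewrite mem_filter h1 h2.
rewrite -size_filter -sum1_size natr_sum mulr_suml big_seq [leRHS]big_seq; apply: ler_sum => v.
by rewrite mem_filter => /andP[_ vC]; rewrite ler_pdivlMr // pr_word_le.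
Qed.

Lemma measurable_Pn n x : measurable (Pn X n x : set shift_space).
Proof.
rewrite (_ : Pn X n x = X `&` occ 0 n [set subword x 0 n]).
  by apply: measurableI => //; exact: measurable_occ.
apply/seteqP; split => y [Xy hy]; split => //.
  by apply/eq_in_map => i; rewrite mem_iota => /andP[_ hi]; rewrite !add0r hy.
move=> i hi; have := congr1 (fun u => nth true u i) hy.
by rewrite /= !nth_subword // !add0r.
Qed.

Lemma Pn_subword n x y : Pn X n x y -> forall m h, (m + h <= n)%N ->
  subword y m%:Z h = subword x m%:Z h.
Proof.
move=> [_ e] m h mh; apply/eq_in_map => i; rewrite mem_iota => /andP[_ hi].
by rewrite -PoszD e //; lia.
Qed.

(* Of the two windows of length h that a window of length n >= 2h contains, one
   lies inside a single block of level j+1, as n <= l_{j+1}. *)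
Lemma pr_Pn_le j h n s x : (2 * h <= n)%N -> (n <= len r j.+1)%N ->
  (forall p, (p + h <= len r j.+1)%N ->
    (s <= #|movable (nwords r j) :&: inside_window (len r j) p h (nwords r j)|)%N) ->
  pr mu (Pn X n x : set shift_space) * s`!%:R <= 2.
Proof.
move=> hn nl hs.
set L := len r j.+1; set S := isqrt (nwords r j).
have L0 : (0 < L)%N by exact: len_gt0.
have s4 : (4 <= nwords r j)%N by apply: leq_trans (nwords_ge64 j hr).
have sS : (s <= S)%N.
  have h0 : (0 + h <= L)%N by rewrite /L; lia.
  apply: (leq_trans (hs _ h0)); rewrite /S -card_movable //; apply: subset_leq_card.
  exact: finset.subsetIl.
(* m, which is 0 or h, starts one of the two windows, and p is its place in its block of level j+1;
   the guard discards windows that leave the block. *)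
pose V (m p : nat) := fun v : seq bool => (p + h <= L)%N && (take h (drop p v) == subword x m%:Z h).
pose A (m p : nat) := occ (m%:Z - p%:Z) L [set w | w \in C j.+1 /\ V m p w].
have L2 : (0 : R) < (len r j.+2)%:R by rewrite ltr0n len_gt0.
have hA m p : pr mu (A m p) <= ((S - s)`!)%:R / (len r j.+2)%:R.
  rewrite pr_occ // ler_pdivlMr //; apply: (le_trans (pr_words_le _ _)).
  rewrite ler_nat; have [pl|pl] := leqP (p + h) L; last first.
    by rewrite (@eq_count _ _ pred0) ?count_pred0 // => v; rewrite /V leqNgt pl.
  apply: (@leq_trans (count (fun v => take h (drop p v) == subword x m%:Z h) (C j.+1))).
    by apply: sub_count => v /andP[].
  apply: (leq_trans (count_window_le hr hC _ pl)); apply: leq_fact.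
  by apply: leq_sub2l; exact: hs.
have := @pr_cover _ _ _ mu X mX hmu _ [seq (m, p) | m <- [:: 0%N; h], p <- iota 0 L]
  (fun mp => A mp.1 mp.2) (Pn X n x).
have mA (i : nat * nat) : measurable (A i.1 i.2) by exact: measurable_occ.
move=> /(_ mA (measurable_Pn n x)) hc.
have {hc} : pr mu (Pn X n x : set shift_space) <=
    \sum_(i <- [seq (m, p) | m <- [:: 0%N; h], p <- iota 0 L]) pr mu (A i.1 i.2).
  apply: hc => y Xy hy.
  have hP := Pn_subword hy.
  have [p [pl _ hp]] := block_starts j.+1 Xy 0.
  have [ph|ph] := leqP (p + h) L.
    exists (0%N, p); first by apply: allpairs_f; rewrite ?mem_iota //= mem_head.
    rewrite /A /occ /=; split; first by move: hp; apply: eq_subword; lia.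
    rewrite /V ph window_subword // -hP ?add0n; last by lia.
    by apply/eqP; congr subword; lia.
  have [p' [pl' hpar hp']] := block_starts j.+1 Xy h%:Z.
  exists (h, p'); first by apply: allpairs_f; rewrite ?mem_iota //= !inE eqxx orbT.
  rewrite /A /occ /=; split; first exact: hp'.
  (* The block containing 0 ends before h, so the block containing h starts after 0: p' < h, hence
     p' + h < 2h <= L. *)
  have [q hq] := recognizability hr hC hpar hp.
  have hp'' : (p' + h <= L)%N.
    have q0 : (q < 0).
      rewrite ltNge; apply/negP => q0.
      have : 0 <= q * (len r j.+1)%:Z by apply: mulr_ge0.
      rewrite -/L in pl pl' hq *; lia.
    have : q * (len r j.+1)%:Z <= - (len r j.+1)%:Z by nia.
    rewrite -/L in pl pl' hq *; lia.
  rewrite /V hp'' window_subword // -hP; last by lia.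
  by apply/eqP; congr subword; lia.
have : \sum_(i <- [seq (m, p) | m <- [:: 0%N; h], p <- iota 0 L]) pr mu (A i.1 i.2) <=
    \sum_(i <- [seq (m, p) | m <- [:: 0%N; h], p <- iota 0 L]) (((S - s)`!)%:R / (len r j.+2)%:R : R).
  by apply: ler_sum => i _.
rewrite big_const_seq count_predT size_allpairs size_iota iter_addr_0 /=.
move=> h1 h2; have h3 := le_trans h2 h1.
have f0 : (0 : R) < s`!%:R by rewrite ltr0n fact_gt0.
rewrite -ler_pdivlMr //; apply: (le_trans h3).
rewrite ler_pdivlMr // -[_ *+ _]mulr_natr.
have -> : (len r j.+2)%:R = (S`!)%:R * L%:R :> R by rewrite -natrM.
have L0' : (0 : R) < L%:R by rewrite ltr0n.
have S0' : (0 : R) < S`!%:R by rewrite ltr0n fact_gt0.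
(* 2L events of probability at most (S-s)! / (S! L) leave 2 / s! divided by a binomial
   coefficient. *)
have -> : (S - s)`!%:R / (S`!%:R * L%:R) * (2 * L)%:R * s`!%:R =
   2 * ((s`! * (S - s)`!)%:R / S`!%:R) :> R.
  by rewrite (natrM _ 2) (natrM _ s`!); field; rewrite (gt_eqF S0') (gt_eqF L0').
rewrite -[leRHS]mulr1 ler_pM2l // ler_pdivrMr // mul1r ler_nat.
by rewrite -(bin_fact sS) leq_pmull // bin_gt0.
Qed.

Lemma fact_le_expn m s : (s <= m)%N -> (m`! <= m ^ s * (m - s)`!)%N.
Proof.
move=> ms; rewrite -(ffact_fact ms) leq_mul2r; apply/orP; right.
by elim: s {ms} => // k IH; rewrite ffactnSr expnSr leq_mul // leq_subr.
Qed.

(** Each word that agrees with the block of x on [p, p+n), placed at -p, contributes a cylinder. At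
    least (S-s)! of the S! words agree, and S! <= S^s (S-s)!. *)
Lemma pr_Pn_ge j p n x : (p + n <= len r j.+1)%N ->
  subword x (- p%:Z) (len r j.+1) \in C j.+1 ->
  1 <= pr mu (Pn X n x : set shift_space) *
    (2 * len r j.+1 * isqrt (nwords r j) ^
      #|movable (nwords r j) :&: meets_window (len r j) p n (nwords r j)|)%:R.
Proof.
move=> pn hx; set s := #|_|; set S := isqrt _; set L := len r j.+1.
pose W := [seq v <- C j.+1 | take n (drop p v) == take n (drop p (subword x (- p%:Z) L))].
have Wn : ((S - s)`! <= size W)%N.
  by rewrite size_filter; apply: count_window_ge.
have L2 : (0 : R) < (2 * len r j.+2)%:R by rewrite ltr0n muln_gt0 len_gt0.
have : \sum_(v <- W) pr mu (occ (- p%:Z) L [set v]) <= pr mu (Pn X n x : set shift_space).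
  apply: (pr_pack mX hmu) => [i||||]; [exact: measurable_occ | exact: measurable_Pn | | |].
  - by rewrite filter_uniq // (uniqC hC).
  - move=> v y; rewrite mem_filter => /andP[/eqP e _] Xy; rewrite /occ /= => hy.
    split=> // i hi; have := congr1 (fun u => nth true u i) e.
    rewrite -hy /= !window_subword // !nth_subword // addNr !add0r //.
  - by move=> v w y _ _ _; rewrite /occ /= => -> ->.
have : (size W)%:R / (2 * len r j.+2)%:R <= \sum_(v <- W) pr mu (occ (- p%:Z) L [set v]).
  rewrite -sum1_size natr_sum mulr_suml big_seq [leRHS]big_seq; apply: ler_sum => v.
  rewrite mem_filter => /andP[_ vC]; rewrite pr_occ // ler_pdivrMr //; exact: pr_word_ge.
move=> h1 h2; have {h1 h2}h := le_trans h1 h2.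
have h3 : ((S - s)`!)%:R / (2 * len r j.+2)%:R <= pr mu (Pn X n x : set shift_space).
  by apply: le_trans h; rewrite ler_pM2r ?invr_gt0 // ler_nat.
have K0 : (0 : R) <= (2 * L * S ^ s)%:R by [].
apply: le_trans (ler_wpM2r K0 h3).
rewrite mulrAC ler_pdivlMr // mul1r -natrM ler_nat.
have -> : (2 * len r j.+2 = 2 * L * S`!)%N by rewrite /L /S /=; lia.
have sS : (s <= S)%N.
  rewrite /S -card_movable; last by apply: leq_trans (nwords_ge64 j hr).
  by apply: subset_leq_card; exact: finset.subsetIl.
by rewrite [leqRHS]mulnC -[leqRHS]mulnA leq_mul2l (fact_le_expn sS) orbT.
Qed.

(* The origin is within N_j letters of an end of its block of level j+1. *)
Definition bad j : set shift_space :=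
  \bigcup_(p in [set` iota 0 (nwords r j) ++ iota (len r j.+1 - nwords r j) (nwords r j)])
    occ (- p%:Z) (len r j.+1) [set` C j.+1].

Lemma measurable_bad j : measurable (bad j).
Proof. by apply: bigcup_measurable => p _; exact: measurable_occ. Qed.

(** There are 2 N_j positions, each of probability at most 1/l_{j+1} = 1/(N_j l_j). *)
Lemma pr_bad j : pr mu (bad j) <= 2 / 2 ^+ j.
Proof.
have L0 : (0 : R) < (len r j.+1)%:R by rewrite ltr0n len_gt0.
set s := iota 0 (nwords r j) ++ iota (len r j.+1 - nwords r j) (nwords r j).
have : pr mu (bad j) <= \sum_(p <- s) pr mu (occ (- p%:Z) (len r j.+1) [set` C j.+1]).
  apply: (pr_cover mX hmu) => [p||y Xy [p ps hy]]; [exact: measurable_occ | exact: measurable_bad |].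
  by exists p.
move=> /le_trans; apply.
under eq_bigr do rewrite pr_occ //.
rewrite big_const_seq count_predT iter_addr_0 -[pr mu _ *+ _]mulr_natr size_cat !size_iota.
have n0 : (0 : R) < (nwords r j)%:R by rewrite ltr0n nwords_gt0.
have e0 : (0 : R) < 2 ^+ j by rewrite exprn_gt0.
apply: (@le_trans _ _ (1 / (len r j.+1)%:R * (nwords r j + nwords r j)%:R)).
  by rewrite ler_wpM2r // ler_pdivlMr // pr_block.
rewrite ler_pdivlMr // /= natrM natrD.
have l0 : (0 : R) < (len r j)%:R by rewrite ltr0n len_gt0.
have -> : 1 / ((nwords r j)%:R * (len r j)%:R) * ((nwords r j)%:R + (nwords r j)%:R) * 2 ^+ j
  = 2 * (2 ^+ j / (len r j)%:R) :> R by field; rewrite (gt_eqF n0) (gt_eqF l0).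
rewrite -[leRHS]mulr1 ler_pM2l // ler_pdivrMr // mul1r -natrX ler_nat.
exact: exp2_le_len.
Qed.

Lemma not_bad j x : X x -> ~ bad j x -> exists p,
  [/\ (nwords r j <= p)%N, (p + nwords r j <= len r j.+1)%N &
      subword x (- p%:Z) (len r j.+1) \in C j.+1].
Proof.
move=> Xx nb; have [p [pl _ hp]] := block_starts j.+1 Xx 0.
rewrite sub0r in hp; exists p; split=> //.
  rewrite leqNgt; apply/negP => h; apply: nb; exists p => //=.
  by rewrite mem_cat mem_iota h.
rewrite leqNgt; apply/negP => h; apply: nb; exists p => //=.
rewrite mem_cat !mem_iota; apply/orP; right; rewrite /= in pl h *; lia.
Qed.

End Measure.

(** * Growth of the information *)

Lemma exp2_le_2fact s : (2 ^ s <= 2 * s`!)%N.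
Proof.
elim: s => // -[|s] IH //; rewrite expnS factS.
have := IH; rewrite /= => h; nia.
Qed.

Lemma fact_le_pow s : (s`! <= s ^ s)%N.
Proof. by have := fact_le_expn (leqnn s); rewrite subnn muln1. Qed.

Section Growth.
Variables (R : realType) (r : nat).
Hypothesis hr : (6 <= r)%N.
Local Notation N j := ((nwords r j)%:R : R).
Local Notation S j := (isqrt (nwords r j)).

Lemma nwords_ge64R j : 64 <= N j.
Proof. by rewrite ler_nat; exact: nwords_ge64. Qed.

Lemma isqrt_le_sqrt n : (isqrt n)%:R <= Num.sqrt n%:R :> R.
Proof.
rewrite -(ler_pXn2r (n := 2)) // ?nnegrE ?sqrtr_ge0 // sqr_sqrtr // -natrX ler_nat.
by rewrite -mulnn; exact: isqrt_sq_le.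
Qed.

Lemma half_le_ln2 : 2^-1 <= ln (2 : R).
Proof.
have -> : ln (2 : R) = - ln (1 + - 2^-1).
  by rewrite (_ : 1 + - 2^-1 = (2 : R)^-1) ?lnV ?posrE ?opprK //; lra.
rewrite lerNr; apply: le_ln1Dx; lra.
Qed.

Lemma ln_nwordsS j : ln (N j.+1) <= Num.sqrt (N j) * ln (N j).
Proof.
have s8 : (8 <= S j)%N by apply: leq_isqrt; exact: nwords_ge64.
have sN : (S j <= nwords r j)%N by apply: leq_trans (isqrt_sq_le _); rewrite leq_pmull //; lia.
apply: (@le_trans _ _ (ln ((S j)%:R ^+ S j : R))).
  rewrite ler_ln ?posrE ?exprn_gt0 ?ltr0n ?fact_gt0 //; try lia.
  by rewrite -natrX ler_nat; exact: fact_le_pow.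
rewrite lnXn ?ltr0n; last by lia.
rewrite -[ln _ *+ _]mulr_natl; apply: ler_pM => //; first by apply: ln_ge0; rewrite ler1n; lia.
  exact: isqrt_le_sqrt.
by rewrite ler_ln ?posrE ?ltr0n ?ler_nat ?nwords_gt0 //; lia.
Qed.

(** l_{j+1} <= N_j^2 < (S+1)^4, while S! >= 2^(S-1) gives S+1 <= 4 log S!; 256 is 4^4. *)
Lemma len_le_ln j : (len r j.+1)%:R <= 256 * ln (N j.+1) ^+ 4.
Proof.
have s8 : (8 <= S j)%N by apply: leq_isqrt; exact: nwords_ge64.
have h1 : (S j).+1%:R <= 4 * ln (N j.+1).
  have h2 := exp2_le_2fact (S j).
  have : ln ((2 : R) ^+ S j) <= ln (2 * (S j)`!%:R).
    by rewrite ler_ln ?posrE ?exprn_gt0 ?mulr_gt0 ?ltr0n ?fact_gt0 // -natrX -natrM ler_nat.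
  rewrite lnXn // lnM ?posrE ?ltr0n ?fact_gt0 // -[ln _ *+ _]mulr_natr => h3.
  have h4 := half_le_ln2; have h5 : 8 <= (S j)%:R :> R by rewrite ler_nat.
  rewrite /= -natr1; nra.
apply: (@le_trans _ _ ((S j).+1%:R ^+ 4)).
  rewrite -natrX ler_nat /=; have := len_le_nwords j hr; have := lt_isqrt_sq (nwords r j).
  set t := (S j).+1; rewrite !expnS expn0 muln1 => a b.
  have := leq_mul (ltnW a) (ltnW a); have := leq_mul (leqnn (nwords r j)) b; lia.
have -> : 256 * ln (N j.+1) ^+ 4 = (4 * ln (N j.+1)) ^+ 4 by rewrite exprMn; congr (_ * _); lra.
by rewrite lerXn2r // nnegrE //; apply: le_trans h1.
Qed.

(** From log (x^e) < x^e; it trades logarithms for arbitrarily small powers. *)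
Lemma ln_le_powR (x e : R) : 0 < x -> 0 < e -> ln x <= x `^ e / e.
Proof.
move=> x0 e0; rewrite ler_pdivlMr // mulrC -ln_powR.
by apply/ltW/ln_sublinear/powR_gt0.
Qed.

End Growth.

(** * Two-sided bounds on the information at a given level *)

Section Bounds.
Variables (R : realType) (r : nat) (C : nat -> seq (seq bool)).
Hypotheses (hr : (6 <= r)%N) (hC : marker_construction r C).
Variable mu : probability shift_space R.
Hypotheses (hmu : mu (marker_shift C) = 1%E)
  (hinv : forall A : set shift_space, measurable A -> mu (sshift @^-1` A) = mu A).
Local Notation X := (marker_shift C : set shift_space).
Local Notation N j := ((nwords r j)%:R : R).

Definition info (x : config) (n : nat) : R := - ln (pr mu (Pn X n x : set shift_space)).

Lemma pr_le1 (A : set shift_space) : measurable A -> pr mu A <= 1.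
Proof. by move=> mA; rewrite -lee_fin -pr_EFin // probability_le1. Qed.

Lemma info_ge0 x n : 0 <= info x n.
Proof. by rewrite oppr_ge0; apply: ln_le0; apply: pr_le1; exact: measurable_Pn. Qed.

(** With q = sqrt N_j and 1 <= l_j <= q^2 one has (n + l_j)^2 <= 4 (n + q)^2 l_j, so
    [card_meets_window] gives s - 2 <= (n + q) / q. *)
Lemma card_meets_window_le j p n : (nwords r j <= p)%N ->
  #|movable (nwords r j) :&: meets_window (len r j) p n (nwords r j)|%:R <=
  n%:R / Num.sqrt (N j) + 3.
Proof.
move=> Np; set s := #|_|.
have lN := len_le_nwords j hr; have l0 := len_gt0 j hr.
have NR : (0 : R) < N j by rewrite ltr0n nwords_gt0.
suff : ((s - 2)%N%:R : R) <= n%:R / Num.sqrt (N j) + 1.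
  have : s%:R <= (s - 2)%N%:R + 2 :> R by rewrite -natrD ler_nat; lia.
  lra.
have : ((4 * (s - 2) ^ 2 * (nwords r j * len r j))%N%:R <= ((n + len r j) ^ 2)%N%:R :> R).
  by rewrite ler_nat; exact: card_meets_window.
rewrite (natrX R (n + len r j)%N 2) natrD !natrM; set d := (s - 2)%N%:R.
have q2 : Num.sqrt (N j) ^+ 2 = N j by rewrite sqr_sqrtr // ltW.
have q1 : 8 <= Num.sqrt (N j).
  by rewrite -(ler_pXn2r (n := 2)) ?nnegrE ?sqrtr_ge0 // q2; have := nwords_ge64R R hr j; lra.
move: q1 q2; set q := Num.sqrt _ => q1 q2 hd.
rewrite leNgt; apply/negP => hlt.
have q0 : 0 < q by lra.
have hlt' : n%:R + q < d * q.
  by move: hlt; rewrite -(ltr_pM2r q0) mulrDl divfK ?gt_eqF // mul1r.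
have l1 : 1 <= (len r j)%:R :> R by rewrite ler1n.
have lq : (len r j)%:R <= q ^+ 2 by rewrite q2 ler_nat.
move: hd; rewrite -q2; move: l1 lq; set l : R := (len r j)%:R => l1 lq.
have n0 : 0 <= n%:R :> R by [].
move: n0 hlt'; set m : R := n%:R => n0 hlt'.
rewrite leNgt => /negP; apply.
have a1 : (m + q) ^+ 2 < (d * q) ^+ 2 by rewrite ltr_pXn2r // nnegrE; nra.
have a2 : (m + q) ^+ 2 * l < (d * q) ^+ 2 * l by rewrite ltr_pM2r //; lra.
have -> : 4 * (d * d) * (q ^+ 2 * l) = 4 * ((d * q) ^+ 2 * l) by ring.
have a3 : m ^+ 2 <= m ^+ 2 * l by rewrite ler_peMr // sqr_ge0.
have a4 : l * l <= q ^+ 2 * l by rewrite ler_pM2r //; lra.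
have a5 : m * l <= m * l * q by rewrite ler_peMr // ?mulr_ge0 //; lra.
nra.
Qed.

Lemma info_le j p n x : (nwords r j <= p)%N -> (p + nwords r j <= len r j.+1)%N ->
  subword x (- p%:Z) (len r j.+1) \in C j.+1 -> (n <= nwords r j)%N ->
  0 < pr mu (Pn X n x : set shift_space) /\
  info x n <= (6 + n%:R / Num.sqrt (N j)) * ln (N j).
Proof.
move=> Np pN hx nN.
have pn : (p + n <= len r j.+1)%N by lia.
have := pr_Pn_ge hr hC hmu hinv pn hx.
set P := pr mu _; set s := #|_|; set S := isqrt _.
have [K eK] : exists K : R, K = (2 * len r j.+1 * S ^ s)%:R by eexists.
rewrite -eK => h.
have P0 : 0 <= P by exact: pr_ge0.
have K0 : 0 < K.
  by rewrite lt_neqAle eK ler0n andbT -eK; apply: contraTneq h => <-; rewrite mulr0 ler10.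
have {}P0 : 0 < P.
  by rewrite lt_neqAle P0 andbT; apply: contraTneq h => <-; rewrite mul0r ler10.
split=> //; rewrite /info -/P.
have lnP : - ln P <= ln K.
  by rewrite lerNl -subr_ge0 opprK -lnM ?posrE // ln_ge0.
apply: (le_trans lnP); rewrite eK.
have N64 := nwords_ge64 j hr; have lN := len_le_nwords j hr; have l0 := len_gt0 j hr.
have S8 : (8 <= S)%N by exact: leq_isqrt.
have sN : (S <= nwords r j)%N by apply: leq_trans (isqrt_sq_le _); rewrite leq_pmull //; lia.
have NR : (0 : R) < N j by rewrite ltr0n; lia.
(* Of the three extra factors N_j, one bounds 2 and two bound l_{j+1} = N_j l_j. *)
apply: (@le_trans _ _ (ln ((N j) ^+ (3 + s)))).
  have K0' : (0 : R) < (2 * len r j.+1 * S ^ s)%:R by rewrite -eK.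
  rewrite ler_ln ?posrE ?exprn_gt0 // -(natrX R (nwords r j)) ler_nat expnD leq_mul //.
    rewrite /= !expnS expn0 muln1.
    have := leq_mul (leqnn (nwords r j)) lN.
    have := leq_mul (leq_trans (isT : 2 <= 64)%N N64) (leqnn (nwords r j * nwords r j)); lia.
  by case: s {h eK K0'} => // s; rewrite leq_exp2r.
rewrite lnXn // -[ln _ *+ _]mulr_natl natrD; apply: ler_wpM2r.
  by apply: ln_ge0; rewrite ler1n; lia.
have := card_meets_window_le n Np; rewrite -/s => h'.
have -> : (6 + n%:R / Num.sqrt (N j) : R) = 3 + (n%:R / Num.sqrt (N j) + 3) by ring.
by rewrite lerD2l.
Qed.

Lemma info_ge j n x : (n <= len r j.+1)%N -> 0 < pr mu (Pn X n x : set shift_space) ->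
  (n%:R / (6 * (len r j)%:R * Num.sqrt (N j)) - 6) * ln 2 <= info x n.
Proof.
move=> nl P0; set h := n./2; set S := isqrt (nwords r j).
have l0 := len_gt0 j hr.
(* [card_inside_window] solved for the number of movable blocks in a window of length h. *)
pose s := ((h %/ len r j - 2) %/ (2 * S + 1) - 2)%N.
have hs p : (p + h <= len r j.+1)%N ->
    (s <= #|movable (nwords r j) :&: inside_window (len r j) p h (nwords r j)|)%N.
  move=> hp; have := card_inside_window l0 hp; rewrite -/S; set c := #|_| => hc.
  rewrite /s leq_subLR addnC -ltnS ltn_divLR; last by lia.
  have : (h %/ len r j <= (c + 2) * (2 * S + 1) + 2)%N.
    by rewrite -ltnS ltn_divLR // mulSn mulnC; lia.
  by rewrite mulSn; lia.
have h2 : (2 * h <= n)%N by rewrite /h; lia.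
have := pr_Pn_le hr hC hmu hinv x h2 nl hs.
move: P0; set P := pr mu _ => P0 hP.
have f0 : 0 < s`!%:R :> R by rewrite ltr0n fact_gt0.
have ln2 := half_le_ln2 R.
have lnP : (s%:R - 2) * ln 2 <= info x n.
  rewrite /info -/P.
  have e1 : ln P + ln (s`!%:R) <= ln (2 : R) by rewrite -lnM ?posrE // ler_ln ?posrE // mulr_gt0.
  have : ln ((2 : R) ^+ s) <= ln (2 * s`!%:R).
    by rewrite ler_ln ?posrE ?exprn_gt0 ?mulr_gt0 // -natrX -natrM ler_nat exp2_le_2fact.
  rewrite lnXn // lnM ?posrE // -[ln _ *+ _]mulr_natr; lra.
apply: le_trans lnP; apply: ler_wpM2r; first lra.
(* The roundings in s cost 4; the factor 2 of [pr_Pn_le] and s! >= 2^(s-1) have cost 2. The divisor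
   6 is 2 from h = n/2 times 3 from 2S+1 <= 3 sqrt N_j. *)
suff : n%:R / (6 * (len r j)%:R * Num.sqrt (N j)) <= s%:R + 4 by lra.
have N64 := nwords_ge64R R hr j.
have q2 : Num.sqrt (N j) ^+ 2 = N j by rewrite sqr_sqrtr //; lra.
have q1 : 8 <= Num.sqrt (N j).
  by rewrite -(ler_pXn2r (n := 2)) ?nnegrE ?sqrtr_ge0 // q2; lra.
have Sq : S%:R <= Num.sqrt (N j) := isqrt_le_sqrt R (nwords r j).
have nS : (n <= 2 * (len r j * ((s + 3) * (2 * S + 1) + 3)))%N.
  have a1 : ((h %/ len r j - 2) < (s + 3) * (2 * S + 1))%N.
    by rewrite -ltn_divLR; [rewrite /s; lia | lia].
  have a2 : (h < (h %/ len r j).+1 * len r j)%N by exact: ltn_ceil.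
  have a3 : ((h %/ len r j).+1 <= (s + 3) * (2 * S + 1) + 2)%N by lia.
  have := leq_trans a2 (leq_mul a3 (leqnn _)).
  by rewrite mulnC mulnDr mulnDr /h; lia.
have l1 : 1 <= (len r j)%:R :> R by rewrite ler1n.
rewrite ler_pdivrMr; last by rewrite !mulr_gt0 //; lra.
have : n%:R <= (2 * (len r j * ((s + 3) * (2 * S + 1) + 3)))%N%:R :> R by rewrite ler_nat.
move=> /le_trans; apply; rewrite !natrM !natrD !natrM natrD.
move: Sq q1 l1; set q := Num.sqrt _; set l : R := (len r j)%:R => Sq q1 l1.
have s0 : 0 <= s%:R :> R by [].
have -> : (s%:R + 4) * (6 * l * q) = 2 * (l * ((s%:R + 3) * (3 * q) + 3 * q)) by ring.
rewrite ler_pM2l // ler_pM2l; last lra.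
apply: lerD; last lra.
rewrite ler_pM2l; lra.
Qed.

End Bounds.

(** * Critical exponents *)

Section Limits.
Variables (R : realType) (u : nat -> nat).
Hypothesis u_ge : forall j, (j <= u j)%N.

Lemma near_le_powR (e A : R) : 0 < e -> \forall j \near \oo, A <= (u j)%:R `^ e.
Proof.
move=> e0; pose B := Num.max A 1.
have B1 : 1 <= B by rewrite le_max lexx orbT.
have : \forall j \near \oo, B `^ e^-1 <= j%:R by exact: nbhs_infty_ger.
apply: filterS => j hj.
apply: (@le_trans _ _ B); first by rewrite le_max lexx.
have -> : B = (B `^ e^-1) `^ e by rewrite -powRrM mulVf ?gt_eqF // powRr1 //; lra.
apply: ge0_ler_powR; rewrite ?nnegrE ?powR_ge0 //; first exact: ltW.
by apply: (le_trans hj); rewrite ler_nat.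
Qed.

Lemma cvg0_le_powR (f : nat -> R) (K e : R) : 0 < e ->
  (\forall j \near \oo, 0 <= f j <= K * (u j)%:R `^ (- e)) -> f @ \oo --> 0.
Proof.
move=> e0 hf; apply/cvgr0Pnorm_le => eps eps0.
have h1 := near_le_powR (`|K| / eps) e0.
have h2 := near_le_powR 1 e0.
near=> j; have /andP[f0 fK] : 0 <= f j <= K * (u j)%:R `^ (- e) by near: j.
rewrite ger0_norm //; apply: (le_trans fK).
have : `|K| / eps <= (u j)%:R `^ e by near: j.
have : 1 <= (u j)%:R `^ e by near: j.
rewrite powRN; set y := _ `^ e => y1.
have y0 : 0 < y by lra.
rewrite ler_pdivrMr // => h; rewrite ler_pdivrMr // [eps * y]mulrC.
exact: le_trans (ler_norm K) h.
Unshelve. all: end_near. Qed.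

Lemma cvgy_ge_powR (f : nat -> R) (k d e : R) : 0 < k -> 0 < e ->
  (\forall j \near \oo, k * (u j)%:R `^ e - d <= f j) -> f @ \oo --> +oo.
Proof.
move=> k0 e0 hf; apply/cvgryPge => A.
have h1 := near_le_powR ((A + d) / k) e0.
near=> j; have : k * (u j)%:R `^ e - d <= f j by near: j.
apply: le_trans; rewrite lerBrDr mulrC -ler_pdivrMr //.
by near: j.
Unshelve. all: end_near. Qed.

(** Since u j >= j, every tail contains u j for all large j, so the suprema of all tails are
    infinite. *)
Lemma limn_esup_pinfty (f : nat -> R) : (fun j => f (u j)) @ \oo --> +oo ->
  limn_esup (fun n => (f n)%:E) = +oo%E.
Proof.
move=> /cvgryPge hf; rewrite limn_esup_lim.
have -> : esups (fun n => (f n)%:E) = fun=> +oo%E.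
  apply/funext => n; apply/eqyP => A _.
  have [m _ hm] := hf A.
  pose k := maxn m n.
  apply: (@le_trans _ _ (f (u k))%:E).
    by rewrite lee_fin; apply: hm; rewrite /= leq_maxl.
  apply: ereal_sup_ubound; exists (u k) => //=.
  by apply: (@leq_trans k) => //; exact: leq_maxr.
exact: lim_cst.
Qed.

End Limits.

(** * Growth rates at the points that avoid the bad events *)

Section Rates.
Variables (R : realType) (r : nat) (C : nat -> seq (seq bool)).
Hypotheses (hr : (6 <= r)%N) (hC : marker_construction r C).
Variable mu : probability shift_space R.
Hypotheses (hmu : mu (marker_shift C) = 1%E)
  (hinv : forall A : set shift_space, measurable A -> mu (sshift @^-1` A) = mu A).
Local Notation X := (marker_shift C : set shift_space).
Local Notation N j := ((nwords r j)%:R : R).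
Local Notation I := (info C mu).

Lemma nwords_ge_id j : (j <= nwords r j)%N.
Proof.
apply: leq_trans (len_le_nwords j hr); apply: leq_trans (exp2_le_len j hr).
by apply/ltnW/ltn_expl.
Qed.

Definition eventually_good (x : config) :=
  X x /\ exists J, forall j, (J <= j)%N -> ~ bad r C j x.

Lemma good_info_le x : eventually_good x -> exists J, forall j n, (J <= j)%N ->
  (n <= nwords r j)%N ->
  0 < pr mu (Pn X n x : set shift_space) /\
  I x n <= (6 + n%:R / Num.sqrt (N j)) * ln (N j).
Proof.
move=> [Xx [J hJ]]; exists J => j n Jj nN.
have [p [p1 p2 p3]] := not_bad hr hC Xx (hJ j Jj).
exact: (info_le hr hC hmu hinv p1 p2 p3 nN).
Qed.

(** For N_j < n <= N_{j+1} = M one has log M <= sqrt n log n. In (6 + n / sqrt M) log M the quotient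
    is at most 1 if n^2 <= M; otherwise it is at most sqrt n, and log M <= 2 log n. *)
Lemma good_info_le_sqrt x : eventually_good x ->
  \forall n \near \oo, I x n <= 8 * Num.sqrt n%:R * ln n%:R.
Proof.
move=> /good_info_le[J hJ]; exists (nwords r J).+1 => // n /= Jn.
have ex : exists j, (n <= nwords r j)%N by exists n; exact: nwords_ge_id.
case: (ex_minnP ex) => -[|j] nj jmin.
  have := jmin _ (nwords_ge_id _ : (n <= nwords r n)%N).
  have : (nwords r 0 <= nwords r J)%N.
    elim: J {hJ Jn} => // J IH; apply: (leq_trans IH).
    apply: leq_trans (nwords_sq_le J hr); rewrite leq_pmulr //; exact: nwords_gt0.
  lia.
have jn : (nwords r j < n)%N.
  by rewrite ltnNge; apply/negP => /jmin; rewrite ltnn.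
have mono a b : (a <= b)%N -> (nwords r a <= nwords r b)%N.
  move=> /subnK <-; elim: (b - a)%N => // k IH; rewrite addSn; apply: (leq_trans IH).
  apply: leq_trans (nwords_sq_le _ hr); rewrite leq_pmulr //; exact: nwords_gt0.
have Jj : (J <= j)%N by rewrite leqNgt; apply/negP => /mono; lia.
have [_ h] := hJ j.+1 n (leqW Jj) nj.
have N64 := nwords_ge64R R hr j; have N64' := nwords_ge64R R hr j.+1.
have Nn : N j <= n%:R by rewrite ler_nat ltnW.
have nN : n%:R <= N j.+1 by rewrite ler_nat.
have l1 := ln_nwordsS R hr j.
move: h N64 N64' Nn nN l1.
set M := N j.+1; set K := N j; set m : R := n%:R => h K64 M64 Km mM l1.
have lm : 0 <= ln m by apply: ln_ge0; lra.
have lM : 0 <= ln M by apply: ln_ge0; lra.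
have sM : 0 < Num.sqrt M by rewrite sqrtr_gt0; lra.
have {}l1 : ln M <= Num.sqrt m * ln m.
  apply: (le_trans l1); apply: ler_pM.
  - exact: sqrtr_ge0.
  - by apply: ln_ge0; lra.
  - by rewrite ler_sqrt //; lra.
  - by rewrite ler_ln ?posrE //; lra.
apply: (le_trans h); rewrite -mulrA.
set A := Num.sqrt m * ln m in l1 *.
have A0 : 0 <= A by rewrite mulr_ge0 // sqrtr_ge0.
have [c|c] := leP (m ^+ 2) M.
  have : m / Num.sqrt M <= 1.
    have [m0 M0] : 0 <= m /\ 0 <= M by split; lra.
    by rewrite ler_pdivrMr // mul1r -(ler_pXn2r (n := 2)) ?nnegrE ?sqrtr_ge0 ?sqr_sqrtr.
  set t := m / _ => t1.
  have : (6 + t) * ln M <= 7 * ln M by apply: ler_wpM2r => //; lra.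
  lra.
have l2 : ln M <= 2 * ln m.
  have -> : 2 * ln m = ln (m ^+ 2) by rewrite lnXn ?mulr_natl //; lra.
  by rewrite ler_ln ?posrE ?exprn_gt0 //; lra.
have : m / Num.sqrt M <= Num.sqrt m.
  have e : m = Num.sqrt m * Num.sqrt m by rewrite -expr2 sqr_sqrtr //; lra.
  rewrite ler_pdivrMr // [X in X <= _]e; apply: ler_wpM2l; first exact: sqrtr_ge0.
  by rewrite ler_sqrt //; lra.
set t := m / _ => t1.
have t2 : t * ln M <= Num.sqrt m * (2 * ln m).
  by apply: ler_pM => //; rewrite /t divr_ge0 ?sqrtr_ge0.
have -> : (6 + t) * ln M = 6 * ln M + t * ln M by ring.
have e : Num.sqrt m * (2 * ln m) = 2 * A by rewrite /A; ring.
lra.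
Qed.

Lemma good_limsup_zero x (b : R) : eventually_good x -> 1 / 2 < b ->
  (fun n => I x n / n%:R `^ b) @ \oo --> 0.
Proof.
(* n^b = n^(1/2) n^e n^e: one n^e absorbs the logarithm, the other forces the limit 0. *)
move=> gx hb; pose e := (b - 1 / 2) / 2.
have e0 : 0 < e by rewrite /e; lra.
have h1 := good_info_le_sqrt gx.
have h2 : \forall n \near \oo, (1 : R) <= n%:R by exact: nbhs_infty_ger.
apply: (@cvg0_le_powR _ id (fun j => leqnn j) _ (8 / e) e e0).
near=> n; have n1 : (1 : R) <= n%:R by near: n.
have n0 : (0 : R) < n%:R by lra.
have hI : I x n <= 8 * Num.sqrt n%:R * ln n%:R by near: n.
have p0 := powR_gt0 b n0.
apply/andP; split; first by rewrite divr_ge0 ?info_ge0 // ltW.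
rewrite ler_pdivrMr //; apply: (le_trans hI).
rewrite -powR12_sqrt ?(ltW n0) //; have hl := ln_le_powR n0 e0.
have s0 := powR_ge0 n%:R (2^-1 : R).
have -> : 8 / e * n%:R `^ (- e) * n%:R `^ b = 8 * n%:R `^ 2^-1 * (n%:R `^ e / e).
  have -> : (b : R) = 2^-1 + (e + e) by rewrite /e; lra.
  have nn x' y' : (n%:R : R) `^ (x' + y') = n%:R `^ x' * n%:R `^ y'.
    by apply: powRD; apply/implyP => _; rewrite gt_eqF.
  rewrite !nn powRN; have := powR_gt0 e n0; set y := _ `^ e => y0.
  by field; rewrite !gt_eqF.
by apply: ler_wpM2l => //; rewrite mulr_ge0.
Unshelve. all: end_near. Qed.

(** * Window lengths of order N_j^c *)

Section Subsequence.
Variable (c : R).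
Hypotheses (c_ge : 1 / 2 <= c) (c_le : c <= 1).

Definition scale (j : nat) : nat := Num.truncn (N j `^ c).

Lemma powRc_ge j : 8 <= N j `^ c.
Proof.
have [c1 c2] : 1 / 2 <= c /\ c <= 1 by [].
have N64 := nwords_ge64R R hr j.
apply: (@le_trans _ _ (N j `^ 2^-1)); last first.
  have N1 : 1 <= N j by lra.
  by apply: (ler_powR N1); rewrite -div1r.
rewrite powR12_sqrt; last lra.
rewrite -(ler_pXn2r (n := 2)) ?nnegrE ?sqrtr_ge0 // sqr_sqrtr; lra.
Qed.

Lemma scale_itv j : (scale j)%:R <= N j `^ c < (scale j).+1%:R.
Proof. by apply: truncn_itv; exact: powR_ge0. Qed.

Lemma powR_le_2scale j : N j `^ c <= 2 * (scale j)%:R.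
Proof.
have [c1 c2] : 1 / 2 <= c /\ c <= 1 by [].
have := powRc_ge j; have /andP[_] := scale_itv j; rewrite -natr1; lra.
Qed.

Lemma scale_gt0 j : (0 < scale j)%N.
Proof.
have [c1 c2] : 1 / 2 <= c /\ c <= 1 by [].
by rewrite -(ltr_nat R); have := powRc_ge j; have := powR_le_2scale j; lra.
Qed.

Lemma scale_le j : (scale j <= nwords r j)%N.
Proof.
have [c1 c2] : 1 / 2 <= c /\ c <= 1 by [].
rewrite -(ler_nat R); have /andP[h _] := scale_itv j; apply: (le_trans h).
have N64 := nwords_ge64R R hr j.
by apply: ler1_powR => //; lra.
Qed.

Lemma scale_lt j : (scale j < scale j.+1)%N.
Proof.
have [c1 c2] : 1 / 2 <= c /\ c <= 1 by [].
rewrite -ltnS -(ltr_nat R); have /andP[h1 _] := scale_itv j.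
have /andP[_ h2] := scale_itv j.+1; apply: le_lt_trans h2.
have y8 := powRc_ge j.
have : N j `^ c * N j `^ c <= N j.+1 `^ c.
  have c0 : 0 <= c by lra.
  rewrite -powRM //; apply: (ge0_ler_powR c0); rewrite ?nnegrE ?mulr_ge0 //.
  by rewrite -natrM ler_nat; exact: nwords_sq_le.
rewrite -natr1; nra.
Qed.

Variable (tau : R).
Hypotheses (tau_ge0 : 0 <= tau) (c_tau : c * (1 - tau) = 1 / 2).

Let N0 j : 0 < N j. Proof. by have := nwords_ge64R R hr j; lra. Qed.

Let powN j x y : N j `^ (x + y) = N j `^ x * N j `^ y.
Proof. by apply: powRD; apply/implyP => _; rewrite gt_eqF. Qed.

Lemma good_scale_zero x (b : R) : eventually_good x -> tau < b ->
  (fun j => I x (scale j) / (scale j)%:R `^ b) @ \oo --> 0.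
Proof.
have [c1 c2 t0 ct] : [/\ 1 / 2 <= c, c <= 1, 0 <= tau & c * (1 - tau) = 1 / 2] by [].
(* c - 1/2 = c tau = c b - 2e: of the two factors N_j^e gained, one absorbs the logarithm and the
   other gives the decay. *)
move=> /good_info_le[J hJ] hb; pose e := c * (b - tau) / 2.
have e0 : 0 < e by rewrite /e divr_gt0 // mulr_gt0; lra.
(* 7 bounds 6 + 1 after factoring out N_j^(c - 1/2) >= 1; 2^b comes from N_j^c <= 2 n_j. *)
apply: (@cvg0_le_powR _ _ nwords_ge_id _ (7 * 2 `^ b / e) e e0).
exists J => // j /= Jj.
have [_ hI] := hJ j _ Jj (scale_le j).
have n0 : (0 : R) < (scale j)%:R by rewrite ltr0n scale_gt0.
have nb : 0 < (scale j)%:R `^ b by exact: powR_gt0.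
apply/andP; split; first by rewrite divr_ge0 ?info_ge0 // ltW.
rewrite ler_pdivrMr //; apply: (le_trans hI).
have y0 : 0 < N j `^ e by apply: powR_gt0; exact: N0.
have z0 : 0 < N j `^ (c - 2^-1) by apply: powR_gt0; exact: N0.
have N64 := nwords_ge64R R hr j.
have q0 : 0 < Num.sqrt (N j) by rewrite sqrtr_gt0.
have h1 : (scale j)%:R / Num.sqrt (N j) <= N j `^ (c - 2^-1).
  rewrite powN powRN powR12_sqrt ?(ltW (N0 j)) // ler_pM2r ?invr_gt0 //.
  by have /andP[] := scale_itv j.
have h2 : 1 <= N j `^ (c - 2^-1).
  have N1 : 1 <= N j by lra.
  by rewrite -[leLHS](powRr0 (N j)); apply: (ler_powR N1); rewrite subr_ge0 -div1r.
have h3 := ln_le_powR (N0 j) e0.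
have l0 : 0 <= ln (N j) by apply: ln_ge0; lra.
have h4 : (N j `^ c) `^ b <= 2 `^ b * (scale j)%:R `^ b.
  rewrite -powRM //.
  have b0 : 0 <= b by lra.
  by apply: (ge0_ler_powR b0); rewrite ?nnegrE ?powR_ge0 ?mulr_ge0 ?powR_le_2scale.
apply: (@le_trans _ _ (7 * N j `^ (c - 2^-1) * (N j `^ e / e))).
  have t1 : 0 <= (scale j)%:R / Num.sqrt (N j) by rewrite divr_ge0 ?sqrtr_ge0.
  by apply: ler_pM => //; lra.
have -> : N j `^ (c - 2^-1) = (N j `^ c) `^ b * N j `^ (- e) * N j `^ (- e).
  by rewrite -powRrM -!powN; congr (_ `^ _); rewrite /e; lra.
rewrite powRN; set y := N j `^ e in y0 *.
have -> : 7 * ((N j `^ c) `^ b * y^-1 * y^-1) * (y / e) = 7 / e * y^-1 * ((N j `^ c) `^ b).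
  by field; rewrite !gt_eqF.
have -> : 7 * 2 `^ b / e * y^-1 * (scale j)%:R `^ b = 7 / e * y^-1 * (2 `^ b * (scale j)%:R `^ b).
  by field; rewrite !gt_eqF.
by apply: ler_wpM2l h4; rewrite !mulr_ge0 // invr_ge0 ltW.
Qed.

Lemma good_scale_pinfty x (b : R) : eventually_good x -> 0 < b -> b < tau -> tau <= 1 / 2 ->
  (fun j => I x (scale j) / (scale j)%:R `^ b) @ \oo --> +oo.
Proof.
have [c1 c2 t0 ct] : [/\ 1 / 2 <= c, c <= 1, 0 <= tau & c * (1 - tau) = 1 / 2] by [].
(* c (1 - b) = 1/2 + 5e: four factors N_j^e absorb l_j, which is at most of order log^4 N_j, and the
   fifth diverges. *)
move=> /good_info_le[J hJ] b0 hb tau_le; pose e := c * (tau - b) / 5.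
have e0 : 0 < e by rewrite /e divr_gt0 // mulr_gt0; lra.
have ln2 := half_le_ln2 R.
(* The constants: 6 from [info_ge], 256 and e^4 from the bound on l_j, 2 from truncating N_j^c. *)
have [K [K0 eK]] : exists K : R, 0 < K /\ K * (12 * 256) = e ^+ 4.
  have D0 : (0 : R) < 12 * 256 by rewrite mulr_gt0 ?ltr0n.
  exists (e ^+ 4 / (12 * 256)); split; last exact: divfK (lt0r_neq0 D0) _.
  by apply: divr_gt0 D0; rewrite exprn_gt0.
have k0 : 0 < K * ln 2 by rewrite mulr_gt0 //; lra.
apply: (cvgy_ge_powR (u := nwords r) nwords_ge_id (d := 6 * ln 2) k0 e0).
(* Level 0 is left out because [len_le_ln] speaks of levels j+1. *)
exists (maxn J 1) => // -[|j'] /=; first by rewrite geq_max ltn0 andbF.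
set j := j'.+1; rewrite geq_max => /andP[Jj _].
have [P0 _] := hJ j _ Jj (scale_le j).
have nL : (scale j <= len r j.+1)%N.
  exact: leq_trans (scale_le j) (nwords_le_len j hr).
have hI := info_ge hr hC hmu hinv nL P0.
have n1 : (1 : R) <= (scale j)%:R by rewrite ler1n scale_gt0.
have n0 : (0 : R) < (scale j)%:R by lra.
have nb : 0 < (scale j)%:R `^ b by exact: powR_gt0.
have nb1 : 1 <= (scale j)%:R `^ b by rewrite -[leLHS](powRr0 (scale j)%:R); apply: (ler_powR n1); exact: ltW.
rewrite ler_pdivlMr //; apply: le_trans hI.
have N64 := nwords_ge64R R hr j.
have y0 : 0 < N j `^ e by apply: powR_gt0; exact: N0.
have q0 : 0 < N j `^ 2^-1 by apply: powR_gt0; exact: N0.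
have l0 : 0 <= ln (N j) by apply: ln_ge0; lra.
have L0 : (0 : R) < (len r j)%:R by rewrite ltr0n len_gt0.
have hl : (len r j)%:R <= 256 * (N j `^ e / e) ^+ 4.
  apply: (le_trans (len_le_ln R hr j')); apply: ler_wpM2l; first exact: ler0n.
  have y1 : 0 <= N j `^ e / e by rewrite divr_ge0 ?powR_ge0 // ltW.
  apply: lerXn2r; [exact: l0 | exact: y1 |].
  exact: ln_le_powR (N0 j) e0.
rewrite -powR12_sqrt ?(ltW (N0 j)) //.
have hn : N j `^ (c * (1 - b)) <= 2 * (scale j)%:R `^ (1 - b).
  rewrite powRrM; apply: (@le_trans _ _ ((2 * (scale j)%:R) `^ (1 - b))).
    have b1 : 0 <= 1 - b by lra.
    by apply: (ge0_ler_powR b1); rewrite ?nnegrE ?powR_ge0 ?mulr_ge0 ?powR_le_2scale.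
  rewrite powRM ?(ltW n0) //; apply: ler_wpM2r; first exact: powR_ge0.
  by apply: ler1_powR; lra.
have en : (scale j)%:R = (scale j)%:R `^ (1 - b) * (scale j)%:R `^ b :> R.
  by rewrite -powRD ?subrK ?powRr1 ?ltW //; apply/implyP => _; rewrite gt_eqF.
have eN : N j `^ (c * (1 - b)) = N j `^ 2^-1 * (N j `^ e * N j `^ e ^+ 4).
  rewrite -powR_mulrn ?powR_ge0 // -powRrM -!powN; congr (_ `^ _).
  have : c * (1 - b) = c * (1 - tau) + c * (tau - b) by ring.
  by rewrite c_tau /e => ->; lra.
move: hn; rewrite eN; set y := N j `^ e in y0 hl *; set q := N j `^ 2^-1 in q0 *.
set z := (scale j)%:R `^ (1 - b) in en *; set w := (scale j)%:R `^ b in nb nb1 en *.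
move=> hn; rewrite en.
(* As w >= 1, the constant 6 of [info_ge] is at most 6 w. *)
suff h : K * y * w <= z * w / (6 * (len r j)%:R * q).
  have -> : (K * ln 2 * y - 6 * ln 2) * w = (K * y * w - 6 * w) * ln 2 by ring.
  by apply: ler_wpM2r; lra.
have LL : 0 < 6 * (len r j)%:R * q by rewrite !mulr_gt0.
rewrite ler_pdivlMr //.
have : K * y * w * (6 * (len r j)%:R * q) <=
       K * y * w * (6 * (256 * (y / e) ^+ 4) * q).
  apply: ler_wpM2l; first by rewrite !mulr_ge0 // ltW.
  apply: ler_wpM2r; first exact: ltW.
  by apply: ler_wpM2l; [exact: ler0n | exact: hl].
move=> /le_trans; apply.
have -> : K * y * w * (6 * (256 * (y / e) ^+ 4) * q) =
   (q * (y * y ^+ 4)) / 2 * w.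
  have -> : K * y * w * (6 * (256 * (y / e) ^+ 4) * q) =
    (K * (12 * 256)) * (q * (y * y ^+ 4)) / 2 * w / e ^+ 4 by field; rewrite gt_eqF.
  by rewrite eK; field; rewrite gt_eqF.
by apply: ler_wpM2r; [rewrite ltW | lra].
Qed.

End Subsequence.
End Rates.

(** * A set of full measure by Borel-Cantelli *)

Section GoodSet.
Variables (R : realType) (r : nat) (C : nat -> seq (seq bool)).
Hypotheses (hr : (6 <= r)%N) (hC : marker_construction r C).
Variable mu : probability shift_space R.
Hypotheses (hmu : mu (marker_shift C) = 1%E)
  (hinv : forall A : set shift_space, measurable A -> mu (sshift @^-1` A) = mu A).
Local Notation X := (marker_shift C : set shift_space).

Lemma mu_limsup_bad : mu (lim_sup_set (bad r C)) = 0%E.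
Proof.
apply: (@lim_sup_set_cvg0 _ _ _ mu) => [j|]; first exact: measurable_bad.
apply: (@le_lt_trans _ _ (4 : R)%:E); last exact: ltry.
(* With 4, the j-th term 4 / 2^(j+1) is exactly the bound 2 / 2^j of [pr_bad]. *)
apply: le_trans (epsilon_trick0 xpredT (ler0n R 4)).
apply: lee_nneseries => [j *|j _]; first exact: measure_ge0.
apply: (@le_trans _ _ (pr mu (bad r C j))%:E).
  by rewrite -pr_EFin; [exact: lexx | exact: measurable_bad].
rewrite lee_fin; apply: (le_trans (pr_bad hr hC hmu hinv j)).
have y0 : 0 < (2 : R) ^+ j by rewrite exprn_gt0.
by rewrite natrX exprS [leRHS](_ : _ = 2 / 2 ^+ j) //; field; rewrite gt_eqF.
Qed.

Definition good_set : set shift_space := X `\` lim_sup_set (bad r C).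

Lemma measurable_limsup_bad : measurable (lim_sup_set (bad r C)).
Proof.
apply: bigcap_measurable => [|n _]; first by exists 0%N.
by apply: bigcup_measurable => j _; exact: measurable_bad.
Qed.

Lemma measurable_good_set : measurable good_set.
Proof.
apply: measurableD; first exact: measurable_marker_shift.
exact: measurable_limsup_bad.
Qed.

Lemma mu_good_set : mu good_set = 1%E.
Proof.
have mL := measurable_limsup_bad; have mG := measurable_good_set.
apply/eqP; rewrite eq_le probability_le1 //= -hmu.
have h : (mu (good_set `|` lim_sup_set (bad r C)) <=
    mu good_set + mu (lim_sup_set (bad r C)))%E by exact: measureU2.
rewrite mu_limsup_bad adde0 in h; apply: le_trans h.
apply: le_measure; rewrite ?inE.
- exact: measurable_marker_shift.
- exact: measurableU.
by move=> y Xy; have [h|h] := pselect (lim_sup_set (bad r C) y); [right | left].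
Qed.

Lemma good_set_eventually x : good_set x -> eventually_good r C x.
Proof.
move=> [Xx nL]; split => //; apply: contrapT => h; apply: nL => n _.
apply: contrapT => h2; apply: h; exists n => j nj bj; apply: h2.
by exists j.
Qed.

End GoodSet.

Theorem theorem4p4 (R : realType) :
  exists r0 : nat, forall (r : nat) (C : nat -> seq (seq bool)),
    (r0 <= r)%N -> marker_construction r C ->
    forall mu : probability shift_space R,
      mu (marker_shift C) = 1%E ->
      (forall A : set shift_space, measurable A -> mu (sshift @^-1` A) = mu A) ->
      let a := fun (x : config) (n : nat) =>
                 - ln (fine (mu (Pn (marker_shift C) n x))) in
      (* (1) *)
      {ae mu, forall x, crit_limsup (a x) (1 / 2)}
      /\
      (* (2) *)
      exists Xhat : set shift_space,
        [/\ measurable Xhat, Xhat `<=` marker_shift C, mu Xhat = 1%E &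
          forall tau : R, 0 <= tau -> tau <= 1 / 2 ->
            exists nj : nat -> nat,
              (forall j, (0 < nj j)%N) /\ (forall j, (nj j < nj j.+1)%N) /\
              forall x, Xhat x -> crit_lim (a x) nj tau].
Proof.
exists 6%N => r C hr hC mu hmu hinv a.
have mG := measurable_good_set r C; have goodE := @good_set_eventually r C.
have lim_tau (tau : R) : 0 <= tau -> tau <= 1 / 2 -> exists nj : nat -> nat,
    (forall j, (0 < nj j)%N) /\ (forall j, (nj j < nj j.+1)%N) /\
    forall x, good_set r C x -> crit_lim (a x) nj tau.
  move=> t0 t1; have u0 : 0 < 1 - tau by lra.
  (* The solution of 1 - 1/(2c) = tau; it maps [0, 1/2] onto [1/2, 1]. *)
  pose c := (2 * (1 - tau))^-1.
  have c_tau : c * (1 - tau) = 1 / 2 by rewrite /c; field; rewrite gt_eqF.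
  have c_ge : 1 / 2 <= c by nra.
  have c_le : c <= 1 by nra.
  exists (scale r c); split; first exact: scale_gt0.
  split; first exact: scale_lt.
  move=> x /goodE gx; split => b.
    by move=> b0 bt; apply: (good_scale_pinfty hr hC hmu hinv c_ge c_le t0 c_tau).
  by move=> tb; apply: (good_scale_zero hr hC hmu hinv c_ge c_le t0 c_tau).
split; last first.
  exists (good_set r C); split => //; first by move=> x [].
  exact: (mu_good_set hr hC hmu hinv).
exists (~` good_set r C); split; first exact: measurableC.
  by rewrite probability_setC // (mu_good_set hr hC hmu hinv) subee.
move=> x /= hx Gx; apply: hx; split => b.
  move=> b0 b1.
  (* The subsequence for tau = 1/2 diverges for every b < 1/2, which makes the limsup infinite. *)
  have [nj [nj0 [njS hnj]]] := lim_tau (1 / 2) ltac:(lra) (lexx _).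
  have nj_id j : (j <= nj j)%N by elim: j => // j IH; apply: leq_ltn_trans IH (njS j).
  apply: (@limn_esup_pinfty R nj nj_id (fun n => a x n / n%:R `^ b)).
  by have [+ _] := hnj x Gx; exact.
move=> hb.
(* For b > 1/2 the whole sequence converges to 0. *)
have h : (fun n => (a x n / n%:R `^ b)%:E) @ \oo --> (0 : R)%:E.
  apply: cvg_EFin; first by apply: nearW.
  exact: (good_limsup_zero hr hC hmu hinv (goodE x Gx) hb).
by rewrite (cvg_limn_einf_sup h).2.
Qed.
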